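(* Let $\rho>0$ and let $T$ be the stream length. There exists a randomized algorithm for the continual distinct elements problem that satisfies $\rho$-zCDP with respect to event-level neighboring streams, works in the general turnstile model, uses space polynomial in $T$, and with probability $1-1/\mathrm{poly}(T)$ solves continual distinct elements estimation with $(\alpha,\beta)$ error where $\alpha=O(\log^{10}(T)/\rho^2)$ and $\beta=O(\log^{10}(T)/\rho^2)$.
   Context: A (general turnstile) stream of length $T$ over universe $[n]$ is a sequence $(a_1,s_1),\dots,(a_T,s_T)$ with $a_i\in[n]$ and $s_i\in\{-1,0,1\}$; the frequency vector $x_t\in\mathbb{Z}^n$ has $x_t[j]=\sum_{i\le t: a_i=j}s_i$ (entries may be negative). The number of distinct elements at time $t$ is $D_t=\|x_t\|_0=|\{j: x_t[j]\neq0\}|$. In the continual problem the algorithm outputs an estimate $\hat D_t$ after the $t$-th update for every $t\in[T]$. It has $(\alpha,\beta)$ error if there exist $p,q\ge1$ with $pq=\alpha$ and $r,s\ge0$ with $r+s=\beta$ such that $D_t/p-r\le\hat D_t\le qD_t+s$ for all $t\in[T]$; ''with probability $1-\gamma$'' means simultaneously for all $t$ (the stream is fixed independently of the algorithm's randomness). Event-level neighboring streams differ in exactly one update. With Rényi divergence $D_\zeta(P\|Q)=\frac{1}{\zeta-1}\log\mathbb{E}_{z\sim P}[(P(z)/Q(z))^{\zeta-1}]$, an algorithm $\mathcal{A}$ is $\rho$-zCDP if $D_\zeta(\mathcal{A}(X)\|\mathcal{A}(X'))\le\rho\zeta$ for all neighboring $X,X'$ and all $\zeta>1$.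
   Formalization: Proved for T ≥ 2 with α ≤ max(1, C·log^10(T)/ρ²), because α = pq ≥ 1 always, so α = O(log^10(T)/ρ²) is impossible when ρ is much larger than log^5 T or when T = 1; space is counted in words of Θ(log(n+T)) bits. *)

(* Defs.v *)
From mathcomp Require Export all_boot all_order all_algebra.
From mathcomp Require Export all_classical all_reals all_analysis.

Set Implicit Arguments.
Unset Strict Implicit.
Unset Printing Implicit Defensive.

Import Order.TTheory GRing.Theory Num.Theory.
Local Open Scope ring_scope.

Definition sign : Type := seq_sub [:: (-1)%R; 0%R; 1%R : int].
Definition update (n : nat) : Type := ('I_n * sign)%type.
Definition stream (n T : nat) : Type := T.-tuple (update n).

(* Ordinals count from 0: index t : 'I_T is the state after t.+1 updates. *)
Definition freq (n T : nat) (X : stream n T) (t : 'I_T) (j : 'I_n) : int :=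
  \sum_(i < T | (i <= t)%N && ((tnth X i).1 == j)) ssval (tnth X i).2.

Definition distinct (n T : nat) (X : stream n T) (t : 'I_T) : nat :=
  #|[set j : 'I_n | freq X t j != 0]%SET|.

Definition neighbors (n T : nat) (X Y : stream n T) : Prop :=
  exists i : 'I_T, tnth X i <> tnth Y i /\
    forall j : 'I_T, j <> i -> tnth X j = tnth Y j.

Record pmf (R : realType) (S : finType) := Pmf {
  pmf_fun :> S -> R;
  pmf_ge0 : forall x, 0 <= pmf_fun x;
  pmf_sum1 : \sum_x pmf_fun x = 1 }.

(* A one-pass streaming algorithm: between two updates it retains nothing but
   an element of [memory].  Fresh randomness is available at every step, but it
   takes up space as soon as it has to be remembered.  The answer emitted after
   an update is a symbol read off the memory, and [estimate] is the real number
   that this symbol stands for. *)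
Record algorithm (R : realType) (n : nat) := Algorithm {
  memory : finType;
  answer : finType;
  start : pmf R memory;
  step : memory -> update n -> pmf R memory;
  output : memory -> answer;
  estimate : answer -> R }.

Section Semantics.
Variables (R : realType) (n : nat) (A : algorithm R n).

(* Probability that A emits exactly the answers z on the updates X, when its
   memory is m before the first of them. *)
Fixpoint emits (m : memory A) (X : seq (update n)) (z : seq (answer A)) : R :=
  match X, z with
  | [::], [::] => 1
  | u :: X', a :: z' =>
      \sum_(m' : memory A | output m' == a) step m u m' * emits m' X' z'
  | _, _ => 0
  end.

Definition law (T : nat) (X : stream n T) (z : T.-tuple (answer A)) : R :=
  \sum_(m : memory A) start A m * emits m X z.

End Semantics.

(* Since x / 0 = 0, the terms with P z = Q z = 0 contribute 0. *)
Definition renyi (R : realType) (S : finType) (zeta : R) (P Q : S -> R) :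
    \bar R :=
  if [forall z, (Q z == 0) ==> (P z == 0)] then
    ((zeta - 1)^-1 * ln (\sum_z P z * (P z / Q z) `^ (zeta - 1)))%:E
  else +oo%E.

Definition zCDP (R : realType) (n T : nat) (rho : R) (A : algorithm R n) :
    Prop :=
  forall X Y : stream n T, neighbors X Y ->
  forall zeta : R, 1 < zeta ->
    (renyi zeta (law (A := A) X) (law (A := A) Y) <= (rho * zeta)%:E)%E.

(* p, q, r, s are fixed for the algorithm: they depend neither on the stream
   nor on the random choices. *)
Definition solves_distinct (R : realType) (n T : nat) (A : algorithm R n)
    (alpha beta gamma : R) : Prop :=
  exists p q r s : R,
    [/\ 1 <= p, 1 <= q & p * q = alpha] /\
    [/\ 0 <= r, 0 <= s & r + s = beta] /\
    forall X : stream n T,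
      1 - gamma <=
      \sum_(z : T.-tuple (answer A) |
             [forall t : 'I_T,
                ((distinct X t)%:R / p - r <= estimate (tnth z t)) &&
                (estimate (tnth z t) <= q * (distinct X t)%:R + s)])
        law X z.

(* Space is counted in machine words of Theta(log (n + T)) bits, so that a word
   holds an element of the universe or a counter bounded by T. *)
Definition word_size (n T : nat) : nat := up_log 2 (n + T).+1.

Definition space (R : realType) (n T : nat) (A : algorithm R n) : nat :=
  up_log (2 ^ word_size n T)%N #|memory A|.

(* Main.v *)
Require Import Defs.
From mathcomp Require Import ring lra zify.

Set Implicit Arguments.
Unset Strict Implicit.
Unset Printing Implicit Defensive.

Import Order.TTheory GRing.Theory Num.Theory.
Local Open Scope ring_scope.

(** A mechanism that is [rho]-differentially private in the pure sense has all
    its Renyi divergences bounded by [rho], hence is [rho]-zCDP.  So it suffices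
    to release integer linear sketches of the stream, perturbed by noise of
    density proportional to [exp (- eps * |x|)] on a cyclic group, where the
    range is finite and the privacy loss is exactly that of the L1 sensitivity.

    The items are first hashed linearly into a group of order [T ^ (c + 4)],
    whose seed takes few words however large the universe is.

    If [rho >= C * ln T ^ 5], the hashed updates are released one by one; with
    high probability all noise vanishes and the answers are exact.

    Otherwise, for every level [i <= log2 T] and each of [O(log T)] repetitions,
    keep the keys with probability [2 ^ - i], give them random signs, and
    maintain the signed sum of the kept frequencies with the dyadic tree
    mechanism, whose total error is [tau = O(ln T ^ 5 / rho)].  If no key with
    nonzero frequency is kept, the sum is 0.  If more than [16 * tau ^ 2] are
    kept, the sum exceeds [2 * tau] in absolute value with probability at least
    1/5 by Paley-Zygmund, whatever the frequencies are.  Hence the largest level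
    at which at least a tenth of the repetitions exceed [tau] determines the
    number of distinct elements up to a factor [O(tau ^ 2 + 1)]. *)

(** * Noisy linear sketches *)

(** The ratio bound makes [P] vanish wherever [Q] does and caps the averaged quantity by
    [exp (rho * (zeta - 1))]. The divergence is thus at most [rho], hence at most [rho * zeta]. *)
Lemma renyi_le_of_ratio (R : realType) (S : finType) (rho zeta : R)
    (P Q : S -> R) :
    0 <= rho -> 1 < zeta -> (forall z, 0 <= P z) -> (forall z, 0 <= Q z) ->
    \sum_z P z <= 1 -> (forall z, P z <= expR rho * Q z) ->
  (renyi zeta P Q <= (rho * zeta)%:E)%E.
Proof.
move=> rho0 zeta1 P0 Q0 sumP ratio; rewrite /renyi ifT; last first.
  apply/forallP => z; apply/implyP => /eqP Qz0.
  by have := ratio z; rewrite Qz0 mulr0 => Pz0; apply/eqP/le_anti/andP; split.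
rewrite lee_fin.
set S0 := \sum_z _.
have z0 : 0 < zeta - 1 by rewrite subr_gt0.
have S0_le : S0 <= expR (rho * (zeta - 1)).
  apply: (@le_trans _ _ (\sum_z P z * expR (rho * (zeta - 1)))).
    apply: ler_sum => z _; apply: ler_wpM2l => //.
    rewrite expRM; apply: ge0_ler_powR; first exact: ltW.
    - by rewrite nnegrE divr_ge0.
    - by rewrite nnegrE expR_ge0.
    have [->|Qz] := eqVneq (Q z) 0; first by rewrite invr0 mulr0 expR_ge0.
    by rewrite ler_pdivrMr // lt_def Qz Q0.
  by rewrite -mulr_suml ler_piMl // expR_ge0.
have lnS : ln S0 <= rho * (zeta - 1).
  have [S0p|S0n] := ltP 0 S0.
    by rewrite -[leRHS]expRK ler_ln // posrE expR_gt0.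
  (* By convention [ln] is 0 on nonpositive arguments. *)
  by rewrite ln0 // mulr_ge0 // ltW.
apply: (@le_trans _ _ rho); last by rewrite ler_peMr // ltW.
by rewrite mulrC ler_pdivrMr.
Qed.

(** * Distance to 0 in a cyclic group *)

Section CyclicNorm.
Variable m : nat.
Implicit Types a b : 'I_m.+2.

Definition cnorm a : nat := minn a (m.+2 - a).

Lemma cnorm0 : cnorm 0 = 0%N.
Proof. by []. Qed.

Lemma cnorm_eq0 a : (cnorm a == 0%N) = (a == 0).
Proof.
have := ltn_ord a.
by rewrite /cnorm -(inj_eq val_inj) /=; lia.
Qed.

Lemma cnormN a : cnorm (- a)%R = cnorm a.
Proof.
rewrite /cnorm /=; have := ltn_ord a.
case: (posnP a) => [->|a0 am]; first by rewrite subn0 modnn.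
by rewrite modn_small; lia.
Qed.

Lemma cnormD a b : (cnorm (a + b)%R <= cnorm a + cnorm b)%N.
Proof.
rewrite /cnorm /=; have am := ltn_ord a; have bm := ltn_ord b.
have [ab|ab] := ltnP (a + b)%N m.+2; first by rewrite modn_small //; lia.
have -> : ((a + b) %% m.+2 = a + b - m.+2)%N.
  rewrite -{1}(subnK ab) modnDr modn_small //; lia.
lia.
Qed.

Lemma cnormB a b : (cnorm (a - b)%R <= cnorm a + cnorm b)%N.
Proof. by rewrite -(cnormN b) cnormD. Qed.

Lemma cnorm_sum (I : Type) (r : seq I) (P : pred I) (F : I -> 'I_m.+2) :
  (cnorm (\sum_(i <- r | P i) F i)%R <= \sum_(i <- r | P i) cnorm (F i))%N.
Proof.
elim/big_rec2: _ => [|i k a _ IH]; first by rewrite cnorm0.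
by apply: (leq_trans (cnormD _ _)); rewrite leq_add2l.
Qed.

(** Up to half the modulus nothing wraps around. With modulus [2 * T + 2], a counter bounded by [T]
    is thus read off the group exactly. *)
Lemma cnorm_intr (z : int) : (2 * `|z| <= m.+2)%N -> cnorm z%:~R = `|z|%N.
Proof.
have nat_case k : (2 * k <= m.+2)%N -> cnorm k%:R = k.
  move=> km; rewrite Zp_nat /cnorm /= modn_small; lia.
case: (intP z) => [|k|k] zm.
- by rewrite cnorm0.
- by rewrite -pmulrn nat_case.
- by rewrite mulrNz cnormN -pmulrn nat_case //; move: zm; rewrite abszN.
Qed.

End CyclicNorm.

(** * Privacy and accuracy of a linear sketch with discrete Laplace noise *)

Section LinearMechanism.
Variables (R : realType) (n T m : nat) (Seed Node Ans : finType).
Variable seed0 : Seed.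
Variable inc : Seed -> nat -> update n -> {ffun Node -> 'I_m.+2}.
Variable dec : Seed -> nat -> {ffun Node -> 'I_m.+2} -> Ans.
Variable est : Ans -> R.
Variable eps : R.

Local Notation sketch := {ffun Node -> 'I_m.+2}.

(** Unnormalized density of independent discrete Laplace variables on the cyclic group, one per
    node. *)
Definition noise_weight (y : sketch) : R :=
  \prod_N expR (- (eps * (cnorm (y N))%:R)).

Definition noise_mass : R := \sum_y noise_weight y.

Lemma noise_weight_gt0 y : 0 < noise_weight y.
Proof. by apply: prodr_gt0 => N _; rewrite expR_gt0. Qed.

Lemma noise_mass_gt0 : 0 < noise_mass.
Proof.
rewrite /noise_mass (bigD1 (0 : sketch)) //= ltr_wpDr ?noise_weight_gt0 //.
by apply: sumr_ge0 => y _; rewrite ltW // noise_weight_gt0.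
Qed.

(** The triangle inequality in each coordinate. The group is closed under shifts, so no truncation
    interferes and the bound holds at every point. *)
Lemma noise_weight_shift (y v v' : sketch) :
  0 <= eps ->
  noise_weight (y - v) <=
  expR (eps * (\sum_N cnorm (v N - v' N)%R)%:R) * noise_weight (y - v').
Proof.
move=> eps0; rewrite /noise_weight natr_sum mulr_sumr expR_sum -big_split /=.
apply: ler_prod => N _; rewrite expR_ge0 /= -expRD ler_expR !ffunE.
rewrite -mulrN -mulrN -mulrDr ler_wpM2l // lerBrDr addrC -lerBrDr opprK -natrD.
rewrite ler_nat; apply: leq_trans (cnormD _ _).
rewrite leq_eqVlt; apply/orP; left; apply/eqP; congr cnorm.
ring.
Qed.

Definition memory_type : finType := (Seed * 'I_T.+1 * sketch)%type.

Definition start_fun (s : memory_type) : R :=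
  if s.1.2 == ord0 then #|Seed|%:R^-1 * (noise_weight s.2 / noise_mass) else 0.

Lemma seed_card_gt0 : 0 < #|Seed|%:R :> R.
Proof. by rewrite ltr0n; apply/card_gt0P; exists seed0. Qed.

Lemma start_fun_ge0 s : 0 <= start_fun s.
Proof.
rewrite /start_fun; case: ifP => // _.
by rewrite mulr_ge0 ?invr_ge0 ?ler0n // divr_ge0 // ltW // ?noise_weight_gt0 //
  noise_mass_gt0.
Qed.

Lemma sum_start (F : memory_type -> R) :
  \sum_s start_fun s * F s =
  \sum_(w : Seed) \sum_(y : sketch)
    #|Seed|%:R^-1 * (noise_weight y / noise_mass) * F (w, ord0, y).
Proof.
transitivity (\sum_(w : Seed) \sum_(t : 'I_T.+1) \sum_(y : sketch)
    start_fun (w, t, y) * F (w, t, y)).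
  by rewrite !pair_bigA; apply: eq_bigr => -[[w t] y].
apply: eq_bigr => w _; rewrite (bigD1 ord0) //= [X in _ + X]big1 ?addr0.
  by apply: eq_bigr => y _; rewrite /start_fun eqxx.
move=> t t0; apply: big1 => y _.
by rewrite /start_fun /= (negbTE t0) mul0r.
Qed.

Lemma seed_noise_sum1 :
  \sum_(w : Seed) \sum_(y : sketch)
    #|Seed|%:R^-1 * (noise_weight y / noise_mass) = 1.
Proof.
under eq_bigr do rewrite -mulr_sumr -mulr_suml divff ?gt_eqF ?noise_mass_gt0 //
  mulr1.
by rewrite sumr_const -[_ *+ #|_|]mulr_natr mulVf // gt_eqF // seed_card_gt0.
Qed.

Lemma start_fun_sum1 : \sum_s start_fun s = 1.
Proof.
under eq_bigr do rewrite -[start_fun _]mulr1.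
rewrite sum_start.
by under eq_bigr do under eq_bigr do rewrite mulr1; exact: seed_noise_sum1.
Qed.

Definition dirac_fun (S : finType) (s0 s : S) : R := (s == s0)%:R.

Lemma dirac_fun_ge0 (S : finType) (s0 s : S) : 0 <= dirac_fun s0 s.
Proof. exact: ler0n. Qed.

Lemma sum_dirac (S : finType) (P : pred S) (s0 : S) (F : S -> R) :
  \sum_(s | P s) dirac_fun s0 s * F s = (P s0)%:R * F s0.
Proof.
case: (boolP (P s0)) => Ps0.
  rewrite (bigD1 s0) //= /dirac_fun eqxx big1 ?addr0 // => s /andP[_ /negbTE->].
  by rewrite mul0r.
rewrite mul0r big1 // => s Ps; rewrite /dirac_fun.
have [ss0|] := eqVneq s s0; last by rewrite mul0r.
by rewrite -ss0 Ps in Ps0.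
Qed.

Lemma dirac_fun_sum1 (S : finType) (s0 : S) : \sum_s dirac_fun s0 s = 1.
Proof.
transitivity (\sum_s dirac_fun s0 s * 1); last by rewrite sum_dirac mulr1.
by apply: eq_bigr => s _; rewrite mulr1.
Qed.

Definition dirac_pmf (S : finType) (s0 : S) : pmf R S :=
  Pmf (dirac_fun_ge0 s0) (dirac_fun_sum1 s0).

Definition next_state (s : memory_type) (u : update n) : memory_type :=
  (s.1.1, inord s.1.2.+1, s.2 + inc s.1.1 s.1.2 u).

(** Seed and noise are drawn once, in the start state, and every later step is deterministic. The
    memory carries a clock because [inc] and [dec] depend on time. *)
Definition mechanism : algorithm R n :=
  @Algorithm R n memory_type Ans (Pmf start_fun_ge0 start_fun_sum1)
    (fun s u => dirac_pmf (next_state s u))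
    (fun s => dec s.1.1 s.1.2 s.2) est.

Lemma card_mechanism_memory :
  #|memory mechanism| = (#|Seed| * T.+1 * m.+2 ^ #|Node|)%N.
Proof. by rewrite /= !card_prod card_ffun !card_ord. Qed.

Definition total (w : Seed) (X : seq (update n)) (k t : nat) (d : update n) :
    sketch :=
  \sum_(k <= i < t) inc w i (nth d X (i - k)).

Fixpoint trace (w : Seed) (t : nat) (y : sketch) (X : seq (update n)) :
    seq Ans :=
  if X is u :: X' then
    let y' := y + inc w t u in dec w t.+1 y' :: trace w t.+1 y' X'
  else [::].

(** From a given state exactly one answer sequence has probability 1. The bound on [t + size X]
    keeps the clock within its range. *)
Lemma emits_mechanism w t y X (z : seq Ans) :
  (t + size X <= T)%N -> size z = size X ->
  emits (A := mechanism) (w, inord t, y) X z = (z == trace w t y X)%:R.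
Proof.
elim: X t y z => [|u X IH] t y [|a z] //= tX [zX].
have tE : (inord t : 'I_T.+1) = t :> nat by rewrite inordK; lia.
rewrite sum_dirac /= tE inordK; last lia.
rewrite /next_state /= tE.
by rewrite IH ?zX //; last lia; rewrite eqseq_cons -natrM mulnb eq_sym.
Qed.

Lemma size_trace w t y X : size (trace w t y X) = size X.
Proof. by elim: X t y => //= u X IH t y; rewrite IH. Qed.

Lemma nth_trace w t y X i d a : (i < size X)%N ->
  nth a (trace w t y X) i =
  dec w (t + i.+1) (y + total w X t (t + i.+1) d).
Proof.
elim: X t y i => //= u X IH t y [|i] iX.
  by rewrite addn1 /total big_nat1 subnn.
rewrite [LHS]/= IH // addSnnS; congr dec; rewrite -addrA; congr (_ + _).
rewrite /total [in RHS]big_ltn; last lia.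
rewrite subnn; congr (_ + _); apply: eq_big_nat => k /andP[tk _].
by rewrite -[(k - t)%N]subnSK.
Qed.

Definition sketch_of (w : Seed) (X : stream n T) : sketch :=
  \sum_(i < T) inc w i (tnth X i).

(** The answer at time [t] depends only on nodes that later updates cannot change. It is therefore
    the same on the current sketch and on the final one. *)
Hypothesis causal : forall w t (y y' : sketch),
  (forall N, (forall i u, (t <= i)%N -> inc w i u N = 0) -> y N = y' N) ->
  dec w t y = dec w t y'.

Definition answers (w : Seed) (y : sketch) : T.-tuple Ans :=
  [tuple dec w i.+1 y | i < T].

(** By [causal], the whole transcript is a function of the seed and of one noisy sketch of the full
    stream. Privacy then only concerns a single release. *)
Lemma trace_answers w (y : sketch) (X : stream n T) :
  trace w 0 y X = answers w (y + sketch_of w X).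
Proof.
have sT : size (trace w 0 y X) = T by rewrite size_trace size_tuple.
(* The empty stream is set apart because [nth] needs a default update, which is taken from [X]. *)
have [T0|T0] := posnP T.
  by rewrite (size0nil (etrans sT T0)) (size0nil (etrans (size_tuple _) T0)).
pose d := tnth X (Ordinal T0).
apply: (@eq_from_nth _ (dec w 0 y)) => [|i]; rewrite sT ?size_tuple // => iT.
rewrite (@nth_trace _ _ _ _ _ d) ?size_tuple // add0n.
rewrite -[in RHS]/(nat_of_ord (Ordinal iT)) -tnth_nth tnth_mktuple /=.
apply: causal => N late; rewrite !ffunE; congr (_ + _).
rewrite /total /sketch_of !sum_ffunE.
have E : \sum_(j < T) inc w j (tnth X j) N =
    \sum_(0 <= j < T) inc w j (nth d X (j - 0)) N.
  by rewrite big_mkord; apply: eq_bigr => j _; rewrite subn0 (tnth_nth d).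
rewrite E [in RHS](@big_cat_nat _ _ _ i.+1) //= [X in _ = _ + X]big_nat_cond.
rewrite [X in _ = _ + X]big1 ?addr0 // => j /andP[/andP[ij _] _].
exact: late.
Qed.

Lemma law_mechanism (X : stream n T) z :
  law (A := mechanism) X z =
  \sum_(w : Seed) \sum_(y : sketch)
    #|Seed|%:R^-1 * (noise_weight y / noise_mass) *
      (z == answers w (y + sketch_of w X))%:R.
Proof.
rewrite /law sum_start; apply: eq_bigr => w _; apply: eq_bigr => y _.
have -> : (w, ord0, y) = (w, inord 0, y) :> memory_type.
  by congr (_, _, _); apply: val_inj; rewrite /= inordK.
by rewrite emits_mechanism ?size_tuple // trace_answers.
Qed.

Lemma law_mechanism_ge0 (X : stream n T) z : 0 <= law (A := mechanism) X z.
Proof.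
rewrite law_mechanism; do 2 (apply: sumr_ge0 => ? _).
rewrite !mulr_ge0 ?invr_ge0 ?ler0n // ltW // ?noise_weight_gt0 //.
exact: noise_mass_gt0.
Qed.

Lemma sum_law_mechanism (X : stream n T) (G : pred (T.-tuple Ans)) :
  \sum_(z | G z) law (A := mechanism) X z =
  \sum_(w : Seed) \sum_(y : sketch)
    #|Seed|%:R^-1 * (noise_weight y / noise_mass) *
      (G (answers w (y + sketch_of w X)))%:R.
Proof.
under eq_bigr do rewrite law_mechanism.
rewrite exchange_big; apply: eq_bigr => w _.
rewrite exchange_big; apply: eq_bigr => y _.
rewrite -mulr_sumr; congr (_ * _).
rewrite -[RHS]mulr1 -(sum_dirac G _ (fun=> 1)).
by apply: eq_bigr => z _; rewrite mulr1.
Qed.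

(** With the noisy sketch as summation variable, the laws of two neighbors differ only by the shift
    of the noise density. The two sketches differ by one update, so they are at L1 distance at most
    [Delta]. *)
Lemma mechanism_zCDP (Delta : nat) (rho : R) :
  0 <= eps -> eps * Delta%:R <= rho ->
  (forall w i u u', \sum_N cnorm (inc w i u N - inc w i u' N)%R <= Delta)%N ->
  zCDP T rho mechanism.
Proof.
move=> eps0 rhoD sens X Y [i [_ XY]] zeta zeta1.
have rho0 : 0 <= rho by apply: le_trans rhoD; rewrite mulr_ge0 // ler0n.
apply: renyi_le_of_ratio => // [z|z||z]; [exact: law_mechanism_ge0..| |].
  rewrite (sum_law_mechanism X xpredT) /=.
  by under eq_bigr do under eq_bigr do rewrite mulr1; rewrite seed_noise_sum1.
have lawE Z : law (A := mechanism) Z z = \sum_(w : Seed) \sum_(y : sketch)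
    #|Seed|%:R^-1 * (noise_weight (y - sketch_of w Z) / noise_mass) *
      (z == answers w y)%:R.
  rewrite law_mechanism; apply: eq_bigr => w _.
  rewrite (reindex_inj (addIr (- sketch_of w Z))) /=.
  by apply: eq_bigr => y _; rewrite subrK.
rewrite !lawE mulr_sumr; apply: ler_sum => w _.
rewrite mulr_sumr; apply: ler_sum => y _.
rewrite [leRHS]mulrA ler_wpM2r ?ler0n // [leRHS]mulrCA ler_wpM2l ?invr_ge0
  ?ler0n //.
rewrite [leRHS]mulrA ler_wpM2r ?invr_ge0 ?(ltW noise_mass_gt0) //.
apply: (le_trans (noise_weight_shift y (sketch_of w X) (sketch_of w Y) eps0)).
rewrite ler_wpM2r ?(ltW (noise_weight_gt0 _)) // ler_expR.
apply: le_trans rhoD; rewrite ler_wpM2l // ler_nat.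
apply: leq_trans (sens w i (tnth X i) (tnth Y i)).
rewrite leq_eqVlt; apply/orP; left; apply/eqP; apply: eq_bigr => N _.
congr cnorm; rewrite /sketch_of !sum_ffunE (bigD1 i) //= [X in _ - X](bigD1 i)
  //=.
rewrite (eq_bigr (fun j : 'I_T => inc w j (tnth Y j) N)); last first.
  by move=> j ji; rewrite XY //; apply/eqP.
by rewrite opprD addrACA subrr addr0.
Qed.

(** Moving coordinate [N] from [a] to 0 multiplies the weight by [exp (eps * cnorm a)], and the
    sketches vanishing at [N] carry at most the total mass. *)
Lemma noise_coord_mass N (a : 'I_m.+2) :
  \sum_(y : sketch | y N == a) noise_weight y <=
  expR (- (eps * (cnorm a)%:R)) * noise_mass.
Proof.
pose v : sketch := [ffun M => if M == N then a else 0].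
rewrite (reindex_inj (addIr v)) /= /noise_mass mulr_sumr.
rewrite [leRHS](bigID (fun y : sketch => y N == 0)) /= -[leLHS]addr0 lerD //.
  rewrite (eq_bigl (fun y : sketch => y N == 0)); last first.
    by move=> y; rewrite !ffunE eqxx -subr_eq0 addrK.
  apply: ler_sum => y /eqP yN; rewrite /noise_weight.
  rewrite (bigD1 N) //= [in leRHS](bigD1 N) //= !ffunE eqxx yN add0r cnorm0.
  rewrite mulr0 oppr0 expR0 mul1r (eq_bigr (fun M => expR (- (eps * (cnorm (y
    M))%:R)))) //.
  by move=> M MN; rewrite !ffunE (negbTE MN) addr0.
by apply: sumr_ge0 => y _; rewrite mulr_ge0 ?expR_ge0 // ltW //
  noise_weight_gt0.
Qed.

(** Union bound over the nodes and over the group elements of norm above [k]. The crude factor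
    [m.+2] counts these elements. *)
Lemma noise_tail (k : nat) : 0 <= eps ->
  \sum_(y : sketch | ~~ [forall N, (cnorm (y N) <= k)%N])
    noise_weight y / noise_mass <=
  #|Node|%:R * m.+2%:R * expR (- (eps * k.+1%:R)).
Proof.
move=> eps0; rewrite -mulr_suml ler_pdivrMr ?noise_mass_gt0 //.
apply: (@le_trans _ _
  (\sum_N \sum_(a : 'I_m.+2 | (k < cnorm a)%N)
      \sum_(y : sketch | y N == a) noise_weight y)).
  under [leRHS]eq_bigr do under eq_bigr do rewrite big_mkcond.
  under [leRHS]eq_bigr do rewrite exchange_big.
  rewrite exchange_big [leLHS]big_mkcond; apply: ler_sum => y _ /=.
  have terms_ge0 : forall N (a : 'I_m.+2),
      0 <= (if y N == a then noise_weight y else 0).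
    by move=> N a; case: ifP => // _; rewrite ltW // noise_weight_gt0.
  case: ifP => [|_]; last by do 2 (apply: sumr_ge0 => ? _); exact: terms_ge0.
  rewrite negb_forall => /existsP[N]; rewrite -ltnNge => kN.
  rewrite (bigD1 N) //= (bigD1 (y N)) //= eqxx -addrA lerDl addr_ge0 //.
    by apply: sumr_ge0.
  by do 2 (apply: sumr_ge0 => ? _).
rewrite -!mulrA [leRHS]mulr_natl.
rewrite -[leRHS]sumr_const; apply: ler_sum => N _.
rewrite mulr_natl -[X in _ *+ X](card_ord m.+2) -[leRHS]sumr_const.
rewrite big_mkcond; apply: ler_sum => a _.
case: ifP => [ka|_]; last by rewrite mulr_ge0 ?expR_ge0 // ltW //
  noise_mass_gt0.
apply: (le_trans (noise_coord_mass _ _)).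
rewrite ler_wpM2r ?(ltW noise_mass_gt0) // ler_expR lerN2 ler_wpM2l //.
by rewrite ler_nat.
Qed.

(** Union bound over the two ways to fail: a seed outside [A], or a noise coordinate of norm above
    [k]. *)
Lemma mechanism_success (X : stream n T) (G : pred (T.-tuple Ans))
    (A : pred Seed) (k : nat) (g1 g2 : R) :
  0 <= eps ->
  (forall w (y : sketch), A w -> (forall N, cnorm (y N) <= k)%N ->
    G (answers w (y + sketch_of w X))) ->
  #|[pred w | ~~ A w]|%:R <= g1 * #|Seed|%:R ->
  #|Node|%:R * m.+2%:R * expR (- (eps * k.+1%:R)) <= g2 ->
  1 - (g1 + g2) <= \sum_(z | G z) law (A := mechanism) X z.
Proof.
move=> eps0 good bad1 bad2; rewrite sum_law_mechanism -[X in X -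
  _]seed_noise_sum1.
rewrite lerBlDr -lerBlDl -sumrB.
under eq_bigr do rewrite -sumrB.
pose B (y : sketch) := [forall N, (cnorm (y N) <= k)%N] : bool.
apply: (@le_trans _ _ (\sum_(w : Seed) \sum_(y : sketch)
    (#|Seed|%:R^-1 * (noise_weight y / noise_mass) * (~~ A w)%:R +
    #|Seed|%:R^-1 * (noise_weight y / noise_mass) * (~~ B y)%:R))).
  apply: ler_sum => w _; apply: ler_sum => y _.
  rewrite -mulrDr -[X in X - _]mulr1 -mulrBr ler_wpM2l //.
    by rewrite mulr_ge0 ?invr_ge0 ?ler0n // divr_ge0 ?(ltW (noise_weight_gt0
      _)) ?(ltW noise_mass_gt0).
  have [Aw|Aw] := boolP (A w); have [/forallP By|By] := boolP (B y);
    [by rewrite good //= subrr addr0|by case: (G _) => /=; lra..].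
under eq_bigr do rewrite big_split.
rewrite big_split /= lerD //.
  under eq_bigr do rewrite -mulr_suml -mulr_sumr -mulr_suml divff ?gt_eqF
    ?noise_mass_gt0 // mulr1.
  rewrite -mulr_sumr -natr_sum mulrC ler_pdivrMr ?seed_card_gt0 //.
  apply: le_trans bad1; rewrite ler_nat -sum1_card [leqRHS]big_mkcond.
  by apply: leq_sum => w _; rewrite inE; case: (A w).
apply: le_trans bad2; apply: le_trans (noise_tail _ eps0).
rewrite [leRHS]big_mkcond.
under eq_bigr do under eq_bigr do rewrite -mulrA.
under eq_bigr do rewrite -mulr_sumr.
rewrite sumr_const -[X in X <= _]mulr_natl mulrA divff ?gt_eqF ?seed_card_gt0
  // mul1r.
apply: ler_sum => y _; rewrite -/(B y); case: (B y); first by rewrite mulr0.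
by rewrite mulr1.
Qed.

End LinearMechanism.

(** * Hashing, sampling and random signs *)

Section Hashing.
Variables (n L m : nat) (enc : 'I_n -> {set 'I_L}).
Hypothesis enc_inj : injective enc.

Local Notation seed := {ffun 'I_L -> 'I_m.+2}.

(** A random linear form on the binary code of the item; the seed holds one group element per bit of
    the code. *)
Definition hash (v : seed) (j : 'I_n) : 'I_m.+2 := \sum_(b in enc j) v b.

Lemma hashD v v' j : hash (v + v') j = hash v j + hash v' j.
Proof. by rewrite /hash -big_split; apply: eq_bigr => b _; rewrite !ffunE. Qed.

Lemma hash_coord (b : 'I_L) a j :
  hash [ffun x => if x == b then a else 0] j = if b \in enc j then a else 0.
Proof.
rewrite /hash; under eq_bigr do rewrite ffunE.
case: ifP => bj; last first.
  apply: big1 => x xj; case: eqP => // xb; by rewrite xb bj in xj.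
by rewrite (bigD1 b) //= eqxx big1 ?addr0 // => x /andP[_ /negbTE->].
Qed.

(* Shifting [v] along a bit on which the two codes differ runs through all the
   values of [hash v j - hash v k]. *)
Lemma hash_collision j k : j != k ->
  (#|[set v | hash v j == hash v k]%SET| * m.+2 <= #|{: seed}|)%N.
Proof.
move=> jk; have [b bjk] : exists b, (b \in enc j) != (b \in enc k).
  apply/existsP; rewrite -[X in is_true X]negbK negb_exists.
  apply: contra_neqN jk => /forallP eq_jk; apply/enc_inj/setP => b.
  by apply/eqP; have := eq_jk b; rewrite negbK.
pose bump (a : 'I_m.+2) : seed := [ffun x => if x == b then a else 0].
pose shift (p : seed * 'I_m.+2) : seed := p.1 + bump p.2.
set C := [set v | _]%SET.
have cancel (z p q : 'I_m.+2) : (z + p) - (z + q) = p - q.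
  by rewrite opprD addrACA subrr add0r.
have shift_inj : {in finset.setX C [set: 'I_m.+2]%SET &, injective shift}.
  move=> [v a] [v' a']; rewrite !inE !andbT /= => /eqP vC /eqP vC' E.
  have : hash (shift (v, a)) j - hash (shift (v, a)) k =
         hash (shift (v', a')) j - hash (shift (v', a')) k by rewrite E.
  rewrite /shift !hashD /= !hash_coord vC vC' !cancel.
  move: bjk; case: (b \in enc j); case: (b \in enc k) => // _ aa'.
    move: aa'; rewrite !subr0 => aa'; subst a'.
    by move: E; rewrite /shift /= => /addIr ->.
  move: aa'; rewrite !sub0r => /oppr_inj aa'; subst a'.
  by move: E; rewrite /shift /= => /addIr ->.
by rewrite -[X in (_ * X)%N](card_ord m.+2) -cardsT -cardsX -(card_in_imset
  shift_inj) max_card.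
Qed.

Lemma hash_collisions (I : finType) (a : I -> 'I_n) :
  (#|[set v | ~~ [forall i, forall i', (hash v (a i) == hash v (a i')) ==> (a i
    == a i')]]%SET|
     * m.+2 <= #|I| ^ 2 * #|{: seed}|)%N.
Proof.
set B := [set v | _]%SET.
have BE : (#|B| <= \sum_(i : I) \sum_(i' : I) (a i != a i') *
             #|[set v | hash v (a i) == hash v (a i')]%SET|)%N.
  apply: (@leq_trans (\sum_(v in B) \sum_(i : I) \sum_(i' : I)
      (a i != a i') * (hash v (a i) == hash v (a i')))%N).
    rewrite -sum1_card; apply: leq_sum => v; rewrite inE.
    rewrite negb_forall => /existsP[i]; rewrite negb_forall => /existsP[i'].
    rewrite negb_imply => /andP[hv av].
    by rewrite (bigD1 i) //= (bigD1 i') //= hv av.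
  rewrite [leqLHS]exchange_big /=; apply: leq_sum => i _.
  rewrite [leqLHS]exchange_big /=; apply: leq_sum => i' _.
  rewrite -big_distrr leq_mul2l; apply/orP; right.
  rewrite -sum1dep_card [leqRHS]big_mkcond [leqLHS]big_mkcond /=;
    apply: leq_sum => v _.
  by case: (v \in B); case: (_ == _).
apply: (@leq_trans (\sum_(i : I) \sum_(i' : I) #|{: seed}|)%N).
  apply: (leq_trans (leq_mul BE (leqnn _))).
  rewrite big_distrl; apply: leq_sum => i _.
  rewrite big_distrl; apply: leq_sum => i' _.
  have [//|ai] := eqVneq (a i) (a i').
  by rewrite mul1n hash_collision.
by rewrite !sum_nat_const mulnA mulnn.
Qed.

End Hashing.

Lemma code_exists (n L : nat) : (n <= 2 ^ L)%N ->
  exists enc : 'I_n -> {set 'I_L}, injective enc.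
Proof.
move=> nL.
have cL : (n <= #|{: {set 'I_L}}|)%N.
  by rewrite -cardsT -powersetT card_powerset cardsT card_ord.
exists (fun j => enum_val (widen_ord cL j)) => j k /enum_val_inj /(congr1 val)
  /= jk.
exact: val_inj.
Qed.

Lemma sign_abs (s : sign) : (`|ssval s| <= 1)%N.
Proof. by case: s => s /=; rewrite !inE => /or3P[] /eqP->. Qed.

Section HashedFrequencies.
Variables (n T : nat) (G : finType) (h : 'I_n -> G) (X : stream n T).

(** The first [t] updates are summed, so index [t] of [freq] corresponds to [t.+1] here. *)
Definition hfreq (t : nat) (g : G) : int :=
  \sum_(i < T | (i < t)%N && (h (tnth X i).1 == g)) ssval (tnth X i).2.

Definition support (t : nat) : {set G} := [set g | hfreq t g != 0]%SET.

(** Only items of the stream can have nonzero frequency, so injectivity of [h] on them preserves the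
    count. *)
Lemma distinct_hashed (t : 'I_T) :
  (forall i i', h (tnth X i).1 = h (tnth X i').1 -> (tnth X i).1 = (tnth X
    i').1) ->
  #|support t.+1| = distinct X t.
Proof.
move=> h_inj; rewrite /distinct.
set F := [set j | _]%SET.
have item j : freq X t j != 0 -> exists i : 'I_T, (tnth X i).1 = j.
  move=> fj; apply/'exists_eqP; rewrite -[X in is_true X]negbK negb_exists.
  apply: contra_neqN fj => /forallP none; apply: big1 => i /andP[_ ij].
  by have := none i; rewrite ij.
have freqE i : hfreq t.+1 (h (tnth X i).1) = freq X t (tnth X i).1.
  apply: eq_bigl => k; rewrite ltnS; congr (_ && _).
  by apply/eqP/eqP => [/h_inj|->].
have hF : {in F &, injective h}.
  move=> j k; rewrite !inE => /item[i <-] /item[i' <-]; exact: h_inj.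
rewrite -(card_in_imset hF); apply: eq_card => g.
apply/idP/imsetP => [|[j jF ->]].
  rewrite inE => fg.
  have [i hi] : exists i : 'I_T, h (tnth X i).1 = g.
    apply/'exists_eqP; rewrite -[X in is_true X]negbK negb_exists.
    apply: contra_neqN fg => /forallP none; apply: big1 => i /andP[_ ij].
    by have := none i; rewrite ij.
  by exists (tnth X i).1 => //; rewrite inE -freqE hi.
move: jF; rewrite !inE => jF; have [i ij] := item _ jF.
by rewrite -ij freqE ij.
Qed.

(** Grouping the updates by hash value: a counter fed update by update computes a linear form in the
    hashed frequencies. *)
Lemma sum_hfreq (t : nat) (f : G -> int) : 
  \sum_(i < T | (i < t)%N) f (h (tnth X i).1) * ssval (tnth X i).2 =
  \sum_g f g * hfreq t g.
Proof.
rewrite (partition_big (fun i : 'I_T => h (tnth X i).1) xpredT) //=.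
apply: eq_bigr => g _; rewrite /hfreq mulr_sumr.
by apply: eq_bigr => i /andP[_ /eqP->].
Qed.

Lemma abs_prefix_sum (t : nat) (f : G -> int) : (forall g, `|f g| <= 1)%N ->
  (`|(\sum_(i < T | (i < t)%N) f (h (tnth X i).1) * ssval (tnth X i).2)%R| <=
    T)%N.
Proof.
move=> f1; have TE : T%:Z = \sum_(i < T) 1 by rewrite sumr_const card_ord natz.
rewrite -lez_nat abszE [leRHS]TE.
apply: (le_trans (ler_norm_sum _ _ _)).
rewrite big_mkcond /=; apply: ler_sum => i _; case: ifP => // _.
rewrite normrM mulr_ile1 //; rewrite -abszE lez_nat;
  [exact: f1|exact: sign_abs].
Qed.

Lemma abs_hfreq (t : nat) g : (`|hfreq t g| <= T)%N.
Proof.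
pose f g' : int := (g' == g)%:R.
have := @abs_prefix_sum t f.
rewrite sum_hfreq (bigD1 g) //= /f eqxx mul1r big1 ?addr0; last first.
  by move=> g' /negbTE ->; rewrite mul0r.
by apply=> g'; case: (g' == g).
Qed.

End HashedFrequencies.

(** Markov's inequality for the weight [2 ^ b], where [b] is the number of bad repetitions. The sum
    of the weights factors over the repetitions. *)
Lemma count_repetitions (I W : finType) (bad : pred W) (K : nat) :
  (#|[set f : {ffun I -> W} | (K <= #|[set r | bad (f r)]|)%N]%SET| * 2 ^ K <=
   (#|W| + #|bad|) ^ #|I|)%N.
Proof.
have -> : ((#|W| + #|bad|) ^ #|I| =
    \sum_(f : {ffun I -> W}) \prod_r (if bad (f r) then 2 else 1))%N.
  rewrite -(bigA_distr_bigA (fun (_ : I) w => (if bad w then 2 else 1)%N)) /=.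
  rewrite prod_nat_const; congr (_ ^ _)%N.
  rewrite -sum1_card -[#|bad|]sum1_card [X in (_ + X)%N]big_mkcond -big_split
    /=.
  by apply: eq_bigr => w _; rewrite unfold_in; case: (bad w).
rewrite -sum1dep_card big_distrl /= [leqLHS]big_mkcond; apply: leq_sum => f _.
case: ifP => // Kf; rewrite mul1n.
rewrite -big_mkcond prod_nat_const leq_exp2l //.
by rewrite (leq_trans Kf) // cardsE.
Qed.

(** * Keeping each key with probability [1 / q] *)

Section Sampling.
Variables (G U : finType) (P : pred U) (q : nat).
Hypothesis card_P : (#|P| * q = #|U|)%N.

Definition sampled (S : {set G}) (u : {ffun G -> U}) : {set G} :=
  [set g in S | P (u g)]%SET.

Lemma count_sampled_at (g : G) :
  (#|[set u : {ffun G -> U} | P (u g)]%SET| * q = #|{: {ffun G -> U}}|)%N.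
Proof.
have cardE (Q : pred U) : #|[set u : {ffun G -> U} | Q (u g)]%SET| =
    (#|Q| * #|U| ^ #|G|.-1)%N.
  transitivity (\sum_(u : {ffun G -> U})
      \prod_g' (if g' == g then Q (u g') : nat else 1%N))%N.
    rewrite -sum1dep_card big_mkcond; apply: eq_bigr => u _.
    rewrite (bigD1 g) //= eqxx big1 ?muln1; first by case: (Q _).
    by move=> g' /negbTE ->.
  rewrite -(bigA_distr_bigA (fun g' a => (if g' == g then Q a : nat else 1%N))).
  rewrite (bigD1 g) //= eqxx; congr (_ * _)%N.
    by rewrite -sum1_card [RHS]big_mkcond; apply: eq_bigr => a _;
      rewrite unfold_in; case: (Q a).
  rewrite (eq_bigr (fun=> #|U|)); last by move=> g' /negbTE->;
    rewrite sum1_card.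
  by rewrite prod_nat_const cardC1.
by rewrite cardE -mulnA [(_ * q)%N]mulnC mulnA card_P card_ffun -expnS prednK
  //; apply/card_gt0P; exists g.
Qed.

(** First moment bound: on average [#|S| / q] keys of [S] are kept. *)
Lemma count_sampled_nonempty (S : {set G}) :
  (#|[set u | (0 < #|sampled S u|)%N]%SET| * q <= #|S| * #|{: {ffun G ->
    U}}|)%N.
Proof.
apply: (@leq_trans ((\sum_(g in S) #|[set u : {ffun G -> U} | P (u g)]%SET|) *
  q))%N.
  rewrite leq_mul2r; apply/orP; right.
  apply: (@leq_trans (\sum_(u : {ffun G -> U}) \sum_(g in S) P (u g))%N).
    rewrite -sum1dep_card big_mkcond; apply: leq_sum => u _; case: ifP => //.
    by case/card_gt0P => g; rewrite inE => /andP[gS Pg];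
      rewrite (bigD1 g) //= Pg.
  rewrite exchange_big; apply: leq_sum => g _.
  rewrite -sum1dep_card [leqRHS]big_mkcond; apply: leq_sum => u _.
  by case: (P _).
rewrite big_distrl /= (eq_bigr _ (fun g _ => count_sampled_at g)).
by rewrite sum_nat_const.
Qed.

End Sampling.

Lemma expRN1_le (R : realType) : expR (-1) <= 2^-1 :> R.
Proof.
rewrite expRN lef_pV2 ?posrE ?expR_gt0 //.
by have := expR_ge1Dx (1 : R); lra.
Qed.

(* A Chernoff bound: the weight exp (- #|sampled S u|) factors over G. *)
Lemma count_undersampled (R : realType) (G U : finType) (P : pred U) (q : nat)
    (S : {set G}) :
  (0 < q)%N -> (#|P| * q = #|U|)%N ->
  #|[set u | (4 * q * #|sampled P S u| <= #|S|)%N]%SET|%:R <=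
  #|{: {ffun G -> U}}|%:R * expR (- (#|S|%:R / (4 * q)%:R)) :> R.
Proof.
move=> q0 cardP.
have q0R : 0 < q%:R :> R by rewrite ltr0n.
pose F g a : R := if (g \in S) && P a then expR (-1) else 1.
have prodF (u : {ffun G -> U}) :
    \prod_g F g (u g) = expR (- #|sampled P S u|%:R).
  rewrite -big_mkcond -[in RHS]mulrN1 [RHS]expRM_natl -prodr_const.
  by apply: eq_bigl => g; rewrite inE.
have factor g : \sum_a F g a <=
    #|U|%:R * (if g \in S then expR (- (2 * q%:R)^-1) else 1).
  rewrite /F; case: (g \in S) => /=; last by rewrite sumr_const mulr1.
  have -> : \sum_a (if P a then expR (-1) else 1) =
      #|U|%:R * (1 - (1 - expR (-1)) / q%:R) :> R.
    rewrite (bigID P) /= (eq_bigr (fun=> expR (-1))); last by move=> a ->.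
    rewrite [X in _ + X](eq_bigr (fun=> 1)); last by move=> a /negbTE->.
    rewrite !sumr_const.
    have <- : (#|P| + #|[predC P]| = #|U|)%N by rewrite cardC.
    have PR : #|P|%:R * q%:R = #|P|%:R + #|[predC P]|%:R :> R.
      by rewrite -natrM cardP -natrD cardC.
    rewrite natrD -PR -[X in X + _]mulr_natr -[_ *+ #|_|]mulr_natr mul1r.
    have -> : #|[pred a | ~~ P a]|%:R = #|P|%:R * q%:R - #|P|%:R :> R.
      by rewrite PR addrC addKr.
    by field; rewrite gt_eqF.
  (* Since [exp (-1) <= 1/2], the factor is at most [1 - 1 / (2 * q)], hence at most
     [exp (- 1 / (2 * q))]. *)
  rewrite ler_wpM2l ?ler0n //; apply: le_trans (expR_ge1Dx _).
  rewrite lerD2l lerN2 invfM ler_wpM2r ?invr_ge0 ?(ltW q0R) //.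
  have := expRN1_le R; lra.
have sumF : \sum_(u : {ffun G -> U}) expR (- #|sampled P S u|%:R) <=
    #|{: {ffun G -> U}}|%:R * expR (- (#|S|%:R / (2 * q%:R))) :> R.
  rewrite -(eq_bigr _ (fun u _ => prodF u)) -(bigA_distr_bigA F) /=.
  apply: (@le_trans _ _ (\prod_(g : G)
      (#|U|%:R * (if g \in S then expR (- (2 * q%:R)^-1) else 1)))).
    apply: ler_prod => g _; rewrite factor andbT.
    by apply: sumr_ge0 => a _; rewrite /F; case: ifP; rewrite ?expR_ge0.
  rewrite big_split /= prodr_const card_ffun natrX -big_mkcond prodr_const.
  by rewrite -mulrN expRM_natl.
rewrite natrM.
set e4 := #|S|%:R / _.
have e2 : #|S|%:R / (2 * q%:R) = e4 + e4 :> R.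
  by rewrite /e4; field; rewrite gt_eqF.
(* Markov's inequality: on the event counted, the weight is at least [exp (- e4)]. This costs half
   of the exponent [e4 + e4]. *)
rewrite -(@ler_pM2r _ (expR (- e4))) ?expR_gt0 //.
rewrite -mulrA -expRD -opprD -e2; apply: le_trans sumF.
rewrite -sum1dep_card natr_sum mulr_suml big_mkcond.
apply: ler_sum => u _; case: ifP => [small|_]; last exact: expR_ge0.
rewrite mul1r ler_expR lerN2 /e4 ler_pdivlMr ?mulr_gt0 ?ltr0n //.
by rewrite -!natrM ler_nat mulnC.
Qed.

(** * Moments and anticoncentration of random signed sums *)

Section RandomSigns.
Variables (R : realType) (G : finType) (x : G -> R).
Local Notation signs := {ffun G -> bool}.

Definition signed_sum (s : seq G) (e : signs) : R :=
  \sum_(g <- s) (-1) ^+ e g * x g.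

Definition flip (g : G) (e : signs) : signs := [ffun k => (k == g) (+) e k].

Lemma flipK g : involutive (flip g).
Proof. by move=> e; apply/ffunP => k; rewrite !ffunE addbA addbb. Qed.

Lemma signed_sum_flip g s e : g \notin s ->
  signed_sum s (flip g e) = signed_sum s e.
Proof.
move=> gs; apply: eq_big_seq => k ks; rewrite ffunE.
by case: eqP => // kg; rewrite -kg ks in gs.
Qed.

Lemma sum_flip g (F : signs -> R) :
  \sum_e F e = \sum_e (F e + F (flip g e)) / 2.
Proof.
rewrite -mulr_suml big_split /=.
have <- : \sum_e F e = \sum_e F (flip g e).
  exact: (reindex_inj (inv_inj (flipK g))).
by rewrite -mulr2n -[_ *+ 2]mulr_natr mulfK // pnatr_eq0.
Qed.

(** Induction on [s]. Averaging over the sign of the new key cancels the odd powers, and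
    [a^2 + 6 a v + 3 v^2 <= 3 (a + v)^2] closes the fourth moment, with [a] the square of the new
    value. *)
Lemma signed_sum_moments (s : seq G) : uniq s ->
  let v := \sum_(g <- s) x g ^+ 2 in
  \sum_e signed_sum s e ^+ 2 = #|{: signs}|%:R * v /\
  \sum_e signed_sum s e ^+ 4 <= 3 * #|{: signs}|%:R * v ^+ 2.
Proof.
elim: s => [|g s IH] /=.
  rewrite big_nil mulr0 expr0n mulr0.
  by split; [|rewrite le_eqVlt; apply/orP; left; apply/eqP];
    apply: big1 => e _; rewrite /signed_sum big_nil expr0n.
case/andP => gs /IH[]; rewrite big_cons; set v := \sum_(k <- s) _ => E2 E4.
have step e : signed_sum (g :: s) e = (-1) ^+ e g * x g + signed_sum s e.
  by rewrite /signed_sum big_cons.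
have stepf e : signed_sum (g :: s) (flip g e) =
    - ((-1) ^+ e g * x g) + signed_sum s e.
  rewrite step signed_sum_flip // ffunE eqxx /= -mulNr; congr (_ * _ + _).
  by case: (e g); rewrite ?opprK.
have sq (e : signs) : ((-1) ^+ e g * x g) ^+ 2 = x g ^+ 2.
  by rewrite exprMn sqrr_sign mul1r.
split.
  rewrite (sum_flip g) (eq_bigr (fun e => x g ^+ 2 + signed_sum s e ^+ 2)).
    by rewrite big_split /= sumr_const E2 -[_ *+ #|_|]mulr_natl mulrDr.
  move=> e _; by rewrite step stepf -(sq e); field.
rewrite (sum_flip g) (eq_bigr (fun e => (x g ^+ 2) ^+ 2 +
    6 * x g ^+ 2 * signed_sum s e ^+ 2 + signed_sum s e ^+ 4)); last first.
  move=> e _; by rewrite step stepf -(sq e); field.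
rewrite !big_split /= sumr_const -mulr_sumr E2 -[_ *+ #|_|]mulr_natl.
have N0 : 0 <= #|{: signs}|%:R :> R by rewrite ler0n.
move: E4; set N := #|_|%:R => E4.
have : 0 <= N * x g ^+ 2 ^+ 2 by rewrite mulr_ge0 // sqr_ge0.
rewrite sqrrD; lra.
Qed.

(* Paley-Zygmund, in the form of the pointwise bound
   [1{Z^2 > v/4} >= (Z^2 / v - 1/4) / 2 - (Z^2 / v - 1/4)^2 / 16]. *)
Lemma signed_sum_anticoncentration (s : seq G) : uniq s ->
  let v := \sum_(g <- s) x g ^+ 2 in
  0 < v ->
  #|{: signs}|%:R <= 5 * #|[set e | v < 4 * signed_sum s e ^+ 2]%SET|%:R :> R.
Proof.
move=> us v v0; have [E2 E4] := signed_sum_moments us.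
rewrite -/v in E2 E4.
set B := [set e | _]%SET; set N := #|{: signs}|%:R in E2 E4 *.
have pointwise e : v / 2 * (signed_sum s e ^+ 2 - v / 4) -
    (signed_sum s e ^+ 2 - v / 4) ^+ 2 / 16 <= v ^+ 2 * (e \in B)%:R.
  rewrite inE; set z := signed_sum s e ^+ 2.
  have [big|small] := boolP (v < 4 * z).
    rewrite mulr1 -subr_ge0; set y := z - v / 4.
    have : 0 <= (y / 4 - v) ^+ 2 by exact: sqr_ge0.
    lra.
  rewrite mulr0; move: small; rewrite -leNgt => small.
  have zv : z - v / 4 <= 0 by lra.
  have := sqr_ge0 (z - v / 4).
  have : v / 2 * (z - v / 4) <= 0 by rewrite mulr_ge0_le0 // divr_ge0 // ltW.
  lra.
have total : \sum_e (v / 2 * (signed_sum s e ^+ 2 - v / 4) -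
    (signed_sum s e ^+ 2 - v / 4) ^+ 2 / 16) <= v ^+ 2 * #|B|%:R.
  apply: (le_trans (ler_sum _ (fun e _ => pointwise e))).
  rewrite -mulr_sumr -natr_sum -sum1_card [in leRHS]big_mkcond /=.
  by rewrite (eq_bigr (fun e => nat_of_bool (e \in B))) // => e _;
    case: (e \in B).
have totalE : \sum_e (v / 2 * (signed_sum s e ^+ 2 - v / 4) -
    (signed_sum s e ^+ 2 - v / 4) ^+ 2 / 16) =
    17 / 32 * v * (\sum_e signed_sum s e ^+ 2) -
    (\sum_e signed_sum s e ^+ 4) / 16 - N * (33 / 256 * v ^+ 2).
  have -> : N * (33 / 256 * v ^+ 2) = \sum_(e : signs) 33 / 256 * v ^+ 2.
    by rewrite sumr_const -[RHS]mulr_natl.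
  rewrite mulr_sumr mulr_suml -!sumrB.
  by apply: eq_bigr => e _; field.
have v2 : 0 < v ^+ 2 by rewrite exprn_gt0.
(* The moments give at least [17/32 - 3/16 - 33/256 = 55/256] times [N * v ^+ 2], which exceeds one
   fifth of it. *)
rewrite -(ler_pM2l v2).
move: total; rewrite totalE E2 => total.
have Nv : 0 <= N * v ^+ 2 by rewrite mulr_ge0 ?ler0n // ltW.
lra.
Qed.

End RandomSigns.

(** * Testing the size of a support by one sampled signed sum *)

Section SignedSampling.
Variables (R : realType) (G U : finType) (P : pred U) (q : nat).
Hypothesis q_gt0 : (0 < q)%N.
Hypothesis card_P : (#|P| * q = #|U|)%N.
Local Notation rep := ({ffun G -> U} * {ffun G -> bool})%type.

Definition coef (w : rep) (g : G) : int :=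
  if P (w.1 g) then (-1) ^+ w.2 g else 0.

Lemma abs_coef w g : (`|coef w g| <= 1)%N.
Proof. by rewrite /coef; case: ifP => //; case: (w.2 g). Qed.

Variable x : G -> int.
Let S := [set g | x g != 0]%SET.

Lemma sum_coef (w : rep) :
  \sum_g coef w g * x g = \sum_(g in sampled P S w.1) (-1) ^+ w.2 g * x g.
Proof.
rewrite [RHS]big_mkcond; apply: eq_bigr => g _; rewrite /coef !inE.
case: (P _); rewrite ?mul0r ?andbF // andbT.
by case: eqVneq => //= ->; rewrite mulr0.
Qed.

(** The sum can be nonzero only if some key of the support is sampled, which has probability at most
    [#|S| / q <= 1/100]. *)
Lemma count_false_detection : (100 * #|S| <= q)%N ->
  (100 * #|[set w : rep | (\sum_g coef w g * x g)%R != 0]%SET| <= #|{: rep}|)%N.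
Proof.
move=> Sq.
have := count_sampled_nonempty card_P S.
set A := [set u | _]%SET => hA.
have BA : (#|[set w : rep | (\sum_g coef w g * x g)%R != 0]%SET| <=
    #|A| * #|{: {ffun G -> bool}}|)%N.
  rewrite -[X in (_ * X)%N]cardsT -cardsX; apply: subset_leq_card.
  apply/fintype.subsetP => w; rewrite !inE andbT sum_coef; apply: contra_neqT.
  rewrite -eqn0Ngt cards_eq0 => /eqP ->.
  by rewrite big_set0.
apply: (leq_trans (leq_mul (leqnn 100) BA)); rewrite card_prod mulnA leq_mul2r.
apply/orP; right; rewrite -(leq_pmul2r q_gt0).
apply: (@leq_trans (100 * (#|S| * #|{: {ffun G -> U}}|))%N).
  by rewrite -mulnA leq_mul2l hA orbT.
by rewrite mulnA mulnC leq_mul2l Sq orbT.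
Qed.

(** The summand 16 makes undersampling have probability at most [exp (-4) <= 1/16]. Otherwise more
    than [16 * tau ^ 2] keys are kept; their frequencies are nonzero integers, so [v] exceeds this
    number too and the sum passes [2 * tau] with probability at least 1/5. Finally
    [15/16 * 1/5 >= 1/6]. *)
Lemma count_missed_detection (tau : nat) :
  ((64 * tau ^ 2 + 16) * q <= #|S|)%N ->
  (6 * #|[set w : rep | (`|(\sum_g coef w g * x g)%R| <= 2 * tau)%N]%SET| <=
   5 * #|{: rep}|)%N.
Proof.
move=> Sq; set B := [set w | _]%SET.
pose V : {set {ffun G -> U}} := [set u | (4 * q * #|sampled P S u| <=
  #|S|)%N]%SET.
have q0R : 0 < q%:R :> R by rewrite ltr0n.
have V16 : #|V|%:R <= #|{: {ffun G -> U}}|%:R / 16 :> R.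
  apply: (le_trans (count_undersampled R S q_gt0 card_P)).
  rewrite ler_wpM2l ?ler0n //.
  apply: (@le_trans _ _ (expR (4%:R * -1))); last first.
    rewrite expRM_natl; apply: (@le_trans _ _ ((2^-1) ^+ 4)).
      by rewrite lerXn2r ?nnegrE ?expR_ge0 ?invr_ge0 // expRN1_le.
    by rewrite exprVn lef_pV2 ?posrE // ?exprn_gt0 // -natrX ler_nat.
  rewrite ler_expR mulrN1 lerN2 ler_pdivlMr ?ltr0n ?muln_gt0 //.
  by rewrite -natrM ler_nat; apply: leq_trans Sq; nia.
pose C u := [set e : {ffun G -> bool} | (u, e) \notin B]%SET.
have hit u : u \notin V ->
    #|{: {ffun G -> bool}}|%:R <= 5 * #|C u|%:R :> R.
  rewrite inE -ltnNge => uV.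
  have big : (16 * tau ^ 2 < #|sampled P S u|)%N by nia.
  pose s := enum (sampled P S u).
  have v_ge : #|sampled P S u|%:R <=
      \sum_(g <- s) ((x g)%:~R : R) ^+ 2.
    rewrite /s big_enum /= -sum1_card natr_sum; apply: ler_sum => g.
    rewrite !inE => /andP[xg _]; rewrite -rmorphXn /= -[1]/(1%:~R) ler_int.
    by rewrite -gtz0_ge1 exprn_even_gt0.
  have v_gt : (16 * tau ^ 2)%:R < \sum_(g <- s) ((x g)%:~R : R) ^+ 2.
    by apply: lt_le_trans v_ge; rewrite ltr_nat.
  apply: (le_trans (signed_sum_anticoncentration (enum_uniq _) _)).
    exact: le_lt_trans v_gt.
  rewrite ler_wpM2l // ler_nat subset_leq_card //.
  apply/fintype.subsetP => e; rewrite !inE => ve.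
  rewrite -ltnNge sum_coef /=.
  move: ve => /(lt_trans v_gt).
  have -> : signed_sum (fun g => (x g)%:~R : R) s e =
      (\sum_(g in sampled P S u) (-1) ^+ e g * x g)%:~R.
    rewrite /signed_sum /s big_enum /= rmorph_sum /=; apply: eq_bigr => g _.
    by rewrite rmorphM rmorphXn rmorphN1.
  set z := \sum_(g in _) _.
  rewrite -rmorphXn /= -[4]/(4%:~R) -intrM -[X in X < _]/((16 * tau ^
    2)%:Z%:~R).
  rewrite ltr_int -(real_normK (num_real z)) -abszE; move: `|z|%N => k.
  rewrite -[4]/(4%:Z) expr2 -!PoszM ltz_nat; nia.
have total : (\sum_(u in ~: V) #|C u| + #|B| <= #|{: rep}|)%N.
  rewrite -(cardsC B) addnC leq_add2l.
  rewrite -[X in (_ <= X)%N]sum1_card.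
  rewrite [leqRHS](eq_bigl (fun w : rep => (w.1, w.2) \notin B)); last first.
    by case=> u e; rewrite inE.
  rewrite -(pair_big_dep xpredT (fun u e => (u, e) \notin B) (fun _ _ => 1%N))
    /=.
  rewrite [leqLHS]big_mkcond; apply: leq_sum => u _; case: ifP => // _.
  by rewrite -sum1_card; apply/eq_leq/eq_bigl => e; rewrite inE.
have : ((\sum_(u in ~: V) #|C u|)%:R + #|B|%:R <= #|{: rep}|%:R :> R).
  by rewrite -natrD ler_nat.
rewrite card_prod natrM.
have : #|{: {ffun G -> U}}|%:R = #|V|%:R + #|~: V|%:R :> R by rewrite -natrD
  cardsC.
have hits : #|~: V|%:R * #|{: {ffun G -> bool}}|%:R <= 5 * (\sum_(u in ~: V)
  #|C u|)%:R :> R.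
  rewrite mulr_natl -sumr_const natr_sum mulr_sumr; apply: ler_sum => u.
  by rewrite inE => /hit.
rewrite -(ler_nat R) !natrM.
move: hits V16.
have : 0 <= #|{: {ffun G -> bool}}|%:R :> R by rewrite ler0n.
have : 0 <= #|{: {ffun G -> U}}|%:R :> R by rewrite ler0n.
move: #|{: {ffun G -> bool}}|%:R #|{: {ffun G -> U}}|%:R #|V|%:R #|~: V|%:R.
move: #|B|%:R (\sum_(u in ~: V) #|C u|)%:R => b c N2 N v v' N0 N20 hits V16 NE
  tot.
have : v' * N2 >= 15 / 16 * (N * N2) by nra.
have : 0 <= N * N2 by rewrite mulr_ge0.
lra.
Qed.

End SignedSampling.

(** * The exact mechanism *)

Lemma sum_cnorm_single (m : nat) (N : finType) (P : pred N) (f : N -> 'I_m.+2) :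
  (forall a b, P a -> P b -> a = b) -> (forall a, ~~ P a -> f a = 0) ->
  (forall a, cnorm (f a) <= 1)%N -> (\sum_a cnorm (f a) <= 1)%N.
Proof.
move=> P1 f0 f1; have [a Pa|none] := pickP P.
  rewrite (bigD1 a) //= big1 ?addn0 // => b ba; rewrite f0 //.
  by apply: contra ba => Pb; apply/eqP/P1.
by rewrite big1 // => a _; rewrite f0 ?none.
Qed.

Lemma cnorm_intr_le1 (m : nat) (z : int) : (`|z| <= 1)%N ->
  (cnorm (z%:~R : 'I_m.+2) <= 1)%N.
Proof. by move=> z1; rewrite cnorm_intr //; lia. Qed.

Definition separated (n T L m : nat) (enc : 'I_n -> {set 'I_L}) (X : stream n T)
    (v : {ffun 'I_L -> 'I_m.+2}) : bool :=
  [forall i, forall i',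
    (hash enc v (tnth X i).1 == hash enc v (tnth X i').1) ==>
    ((tnth X i).1 == (tnth X i').1)].

Lemma separatedP (n T L m : nat) (enc : 'I_n -> {set 'I_L}) (X : stream n T)
    (v : {ffun 'I_L -> 'I_m.+2}) (t : 'I_T) :
  separated enc X v -> #|support (hash enc v) X t.+1| = distinct X t.
Proof.
move=> sep; apply: distinct_hashed => i i' hE; apply/eqP.
by have /forallP/(_ i)/forallP/(_ i') := sep; rewrite hE eqxx.
Qed.

Lemma count_not_separated (R : realType) (n T L m : nat)
    (enc : 'I_n -> {set 'I_L}) (X : stream n T) (g : R) :
  injective enc -> (T ^ 2)%:R <= g * m.+2%:R ->
  #|[set v : {ffun 'I_L -> 'I_m.+2} | ~~ separated enc X v]%SET|%:R <=
  g * #|{: {ffun 'I_L -> 'I_m.+2}}|%:R.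
Proof.
move=> enc_inj gT.
have m0 : 0 < m.+2%:R :> R by rewrite ltr0n.
rewrite -(ler_pM2r m0) mulrAC -natrM.
apply: (@le_trans _ _ ((T ^ 2)%:R * #|{: {ffun 'I_L -> 'I_m.+2}}|%:R));
  last first.
  by rewrite ler_wpM2r ?ler0n.
rewrite -natrM ler_nat.
by have := hash_collisions m enc_inj (fun i : 'I_T => (tnth X i).1);
  rewrite card_ord.
Qed.

Section Exact.
Variables (R : realType) (n T L gm : nat) (enc : 'I_n -> {set 'I_L}).
Hypothesis enc_inj : injective enc.
Local Notation G := 'I_gm.+2.
Local Notation m := (2 * T)%N.
Local Notation seed := {ffun 'I_L -> G}.
Local Notation node := ('I_T * G)%type.

(** Node [(i, g)] is written by update [i] alone, so an update changes one cell, and replacing it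
    changes at most two. *)
Definition exact_inc (v : seed) (t : nat) (u : update n) :
    {ffun node -> 'I_m.+2} :=
  [ffun N : node => if (N.1 == t :> nat) && (N.2 == hash enc v u.1)
             then (ssval u.2)%:~R else 0].

Definition exact_dec (v : seed) (t : nat) (y : {ffun node -> 'I_m.+2}) :
    {set G} :=
  [set g | \sum_(i < T | (i < t)%N) y (i, g) != 0]%SET.

Definition exact_mechanism (eps : R) : algorithm R n :=
  mechanism T (0 : seed) exact_inc exact_dec (fun A => #|A|%:R) eps.

Lemma exact_causal v t (y y' : {ffun node -> 'I_m.+2}) :
  (forall N, (forall i u, (t <= i)%N -> exact_inc v i u N = 0) -> y N = y' N) ->
  exact_dec v t y = exact_dec v t y'.
Proof.
move=> yy'; apply/setP => g; rewrite !inE; congr (_ != _).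
apply: eq_bigr => i it; apply: yy' => j u tj; rewrite ffunE /=.
by rewrite (_ : _ == _ = false) //; apply/eqP; lia.
Qed.

Lemma exact_sensitivity v t u u' :
  (\sum_N cnorm (exact_inc v t u N - exact_inc v t u' N)%R <= 2)%N.
Proof.
have one w : (\sum_N cnorm (exact_inc v t w N) <= 1)%N.
  apply: (@sum_cnorm_single _ _
    (fun N : node => (N.1 == t :> nat) && (N.2 == hash enc v w.1)) (exact_inc v
      t w)).
  - move=> [i g] [i' g'] /= /andP[/eqP it /eqP->] /andP[/eqP it' /eqP->].
    by congr (_, _); apply: val_inj; rewrite /= it it'.
  - by move=> N /negbTE E; rewrite ffunE E.
  - move=> N; rewrite ffunE; case: ifP => // _.
    by rewrite cnorm_intr_le1 // sign_abs.
apply: leq_trans (leq_add (one u) (one u')).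
by rewrite -big_split; apply: leq_sum => N _; exact: cnormB.
Qed.

Lemma exact_sketch v (X : stream n T) (i : 'I_T) g :
  sketch_of exact_inc v X (i, g) =
  if hash enc v (tnth X i).1 == g then (ssval (tnth X i).2)%:~R else 0.
Proof.
rewrite /sketch_of sum_ffunE (bigD1 i) //= ffunE /= eqxx /= eq_sym.
rewrite big1 ?addr0 // => j ji; rewrite ffunE /= (_ : _ == _ = false) //.
by rewrite eq_sym -[RHS](negbTE ji).
Qed.

Lemma exact_answer v (X : stream n T) (t : 'I_T) : separated enc X v ->
  #|exact_dec v t.+1 (sketch_of exact_inc v X)| = distinct X t.
Proof.
move=> sep; rewrite -(separatedP t sep); apply: eq_card => g; rewrite !inE.
rewrite (eq_bigr _ (fun i _ => exact_sketch v X i g)) -big_mkcondr /=.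
have -> : \sum_(i < T | (i < t.+1)%N && (hash enc v (tnth X i).1 == g))
    (ssval (tnth X i).2)%:~R = (hfreq (hash enc v) X t.+1 g)%:~R :> 'I_m.+2.
  by rewrite rmorph_sum.
rewrite -cnorm_eq0 cnorm_intr ?absz_eq0 //.
have := abs_hfreq (hash enc v) X t.+1 g; lia.
Qed.

Lemma exact_zCDP (eps rho : R) : 0 <= eps -> eps * 2 <= rho ->
  zCDP T rho (exact_mechanism eps).
Proof.
move=> eps0 er; apply: (mechanism_zCDP _ _ exact_causal (Delta := 2)) => //.
exact: exact_sensitivity.
Qed.

Lemma exact_solves (eps g1 g2 gamma : R) : 0 <= eps ->
  (T ^ 2)%:R <= g1 * gm.+2%:R ->
  (T * gm.+2 * m.+2)%:R * expR (- eps) <= g2 -> g1 + g2 <= gamma ->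
  solves_distinct T (exact_mechanism eps) 1 0 gamma.
Proof.
move=> eps0 hg1 hg2 g12; exists 1, 1, 0, 0; split; first by rewrite mulr1.
split; first by rewrite addr0.
move=> X; apply: (@le_trans _ _ (1 - (g1 + g2))); first by rewrite lerD2l lerN2.
(* With [k = 0] the good event is that all noise vanishes, so the answers are exact. *)
apply: (mechanism_success _ _ exact_causal (A := separated enc X) (k := 0)) =>
  //.
- move=> v y sep y0; apply/forallP => t; rewrite tnth_mktuple.
  have -> : y = 0.
    apply/ffunP => N; rewrite !ffunE; apply/eqP.
    by rewrite -cnorm_eq0 -leqn0 y0.
  by rewrite add0r /= exact_answer // divr1 subr0 mul1r addr0 lexx.
- apply: le_trans (count_not_separated X enc_inj hg1); rewrite ler_nat.
  by apply/eq_leq/eq_card => v; rewrite !inE.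
- by rewrite mulr1 -natrM card_prod !card_ord.
Qed.

Lemma card_exact_memory (eps : R) :
  #|memory (exact_mechanism eps)| =
  (gm.+2 ^ L * T.+1 * m.+2 ^ (T * gm.+2))%N.
Proof. by rewrite card_mechanism_memory card_ffun card_prod !card_ord. Qed.

End Exact.

(** * The approximate mechanism *)

Lemma card_support (n T : nat) (G : finType) (h : 'I_n -> G) (X : stream n T) t
  :
  (#|support h X t| <= T)%N.
Proof.
apply: (@leq_trans #|[set h (tnth X i).1 | i in 'I_T]%SET|); last first.
  by rewrite (leq_trans (leq_imset_card _ _)) // card_ord.
apply/subset_leq_card/fintype.subsetP => g; rewrite inE => gn0; apply/imsetP.
have [i /eqP hi|none] := pickP (fun i : 'I_T => h (tnth X i).1 == g).
  by exists i.
move: gn0; rewrite /hfreq big1 ?eqxx // => i /andP[_].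
by rewrite none.
Qed.

(* The blocks [b * 2^k, (b+1) * 2^k) with [b + 1 = t / 2^k] odd partition
   [0, t). *)
Lemma dyadic_prefix (d j t : nat) : (t < 2 ^ d)%N ->
  (\sum_(k < d | odd (t %/ 2 ^ k)) (j %/ 2 ^ k == (t %/ 2 ^ k).-1) = (j < t))%N.
Proof.
move=> td.
(* The second summand tells whether [j] lies in the part of the prefix made of full blocks of length
   [2 ^ d']. Each new scale splits off at most one block from that part. *)
suff /(_ d (leqnn d)) : forall d', (d' <= d)%N ->
    (\sum_(k < d' | odd (t %/ 2 ^ k)) (j %/ 2 ^ k == (t %/ 2 ^ k).-1)
     + (j %/ 2 ^ d' < t %/ 2 ^ d') = (j < t))%N.
  by rewrite (divn_small td) addn0.
elim=> [|e IH] ed; first by rewrite big_ord0 !divn1.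
rewrite -(IH (ltnW ed)) big_mkcond big_ord_recr -big_mkcond /= -addnA.
congr addn; rewrite expnSr !divnMA.
move: (t %/ 2 ^ e)%N (j %/ 2 ^ e)%N => b a.
case: ifP => ob; lia.
Qed.

(** The bound of [count_repetitions] taken ten repetitions at a time: each ten contribute a factor
    [a ^+ 10 / 2 ^+ s]. *)
Lemma repetition_tail (R : realType) (W : finType) (bad : pred W) (rp s : nat)
    (a delta : R) :
  #|W|%:R + #|bad|%:R <= a * #|W|%:R -> 0 <= a -> a ^+ 10 <= delta * 2 ^+ s ->
  #|[set f : {ffun 'I_(10 * rp) -> W} | (s * rp <= #|[set r | bad (f
    r)]|)%N]%SET|%:R <=
  delta ^+ rp * #|{: {ffun 'I_(10 * rp) -> W}}|%:R.
Proof.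
move=> Wbad a0 ad; set F := [set f | _]%SET.
have p2 : 0 < (2 : R) ^+ (s * rp) by rewrite exprn_gt0.
rewrite -(ler_pM2r p2).
have := @count_repetitions 'I_(10 * rp) W bad (s * rp).
rewrite -/F card_ord -(ler_nat R) natrM natrX => /le_trans; apply.
rewrite natrX natrD; apply: (@le_trans _ _ ((a * #|W|%:R) ^+ (10 * rp))).
  by rewrite lerXn2r ?nnegrE ?addr_ge0 ?mulr_ge0 ?ler0n.
rewrite card_ffun card_ord natrX exprMn mulrAC ler_wpM2r ?exprn_ge0 ?ler0n //.
rewrite !exprM -exprMn lerXn2r ?nnegrE ?exprn_ge0 //.
by apply: le_trans ad; rewrite exprn_ge0.
Qed.

Section Approximate.
Variables (R : realType) (n T L gm lg rp k0 : nat) (enc : 'I_n -> {set 'I_L}).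
Local Notation G := 'I_gm.+2.
Local Notation m := (2 * T)%N.
Local Notation seed := {ffun 'I_L -> G}.
Local Notation rep := ({ffun G -> 'I_(2 ^ lg)} * {ffun G -> bool})%type.
Local Notation table := {ffun 'I_(10 * rp) -> rep}.
Local Notation node := ('I_lg.+1 * 'I_(10 * rp) * 'I_lg.+1 * 'I_T.+1)%type.
Local Notation sketch := {ffun node -> 'I_m.+2}.

(** A prefix uses at most [lg.+1] dyadic blocks, each with noise at most [k0]. *)
Let tau : nat := (lg.+1 * k0)%N.
Let K : nat := (64 * tau ^ 2 + 16)%N.

(** A uniform label below [2 ^ lg] passes with probability [2 ^ - i]; one label per key serves all
    levels, so the samples are nested. *)
Definition level (i : nat) : pred 'I_(2 ^ lg) := fun u => (u < 2 ^ (lg - i))%N.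

Lemma card_level (i : 'I_lg.+1) : (#|level i| * 2 ^ i = #|'I_(2 ^ lg)|)%N.
Proof.
have ilg : (i <= lg)%N by rewrite -ltnS.
have le : (2 ^ (lg - i) <= 2 ^ lg)%N by rewrite leq_exp2l // leq_subr.
have -> : #|level i| = (2 ^ (lg - i))%N.
  have widen_inj : injective (widen_ord le).
    by move=> u v /(congr1 val) uv; apply: val_inj.
  rewrite -[RHS]card_ord -(card_imset _ widen_inj).
  apply: eq_card => u; apply/idP/imsetP => [ul|[v _ ->]].
    by exists (Ordinal ul) => //; apply: val_inj.
  exact: (ltn_ord v).
by rewrite card_ord -expnD subnK.
Qed.

(** A node is a level, a repetition, a dyadic scale [k] and a block index; update [t] enters block
    [t / 2 ^ k] at every scale. *)
Definition approx_inc (w : seed * table) (t : nat) (u : update n) : sketch :=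
  [ffun N : node => if (t %/ 2 ^ N.1.2)%N == N.2
     then (coef (level N.1.1.1) (w.2 N.1.1.2) (hash enc w.1 u.1) * ssval
       u.2)%:~R
     else 0].

Definition prefix_sum (t : nat) (y : sketch) (i : 'I_lg.+1) (r : 'I_(10 * rp)) :
    'I_m.+2 :=
  \sum_(k < lg.+1 | odd (t %/ 2 ^ k)) y (i, r, k, inord (t %/ 2 ^ k).-1).

(** There are [10 * rp] repetitions, so the threshold [rp] is one tenth of them. *)
Definition approx_dec (w : seed * table) (t : nat) (y : sketch) :
    {ffun 'I_lg.+1 -> bool} :=
  [ffun i => (rp <= #|[set r | (tau < cnorm (prefix_sum t y i r))%N]%SET|)%N].

Definition approx_est (f : {ffun 'I_lg.+1 -> bool}) : R :=
  (\max_(i | f i) 2 ^ i)%N%:R.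

Lemma pow2_gt0 : (0 < 2 ^ lg)%N.
Proof. by rewrite expn_gt0. Qed.

Definition rep0 : rep := ([ffun=> Ordinal pow2_gt0], [ffun=> false]).

Definition approx_mechanism (eps : R) : algorithm R n :=
  mechanism T ((0, [ffun=> rep0]) : seed * table)
    approx_inc approx_dec approx_est eps.

Lemma approx_causal w t (y y' : sketch) :
  (forall N, (forall i u, (t <= i)%N -> approx_inc w i u N = 0) -> y N = y' N)
    ->
  approx_dec w t y = approx_dec w t y'.
Proof.
move=> yy'; apply/ffunP => i; rewrite !ffunE; congr (_ <= _)%N.
apply: eq_card => r; rewrite !inE; congr (_ < cnorm _)%N.
apply: eq_bigr => k ok; apply: yy' => j u tj; rewrite ffunE /=.
rewrite (_ : _ == _ = false) //; apply/eqP => jE.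
have tk : (t %/ 2 ^ k <= j %/ 2 ^ k)%N by rewrite leq_div2r.
have t0 : (0 < t %/ 2 ^ k)%N by case: (t %/ 2 ^ k)%N ok.
move: tk; rewrite jE; apply/negP; rewrite -ltnNge.
(* When the index overflows, [inord] still returns a value at most [T], which is below
   [t / 2 ^ k]. *)
have [small|large] := ltnP (t %/ 2 ^ k).-1 T.+1; first by rewrite inordK //;
  lia.
have := ltn_ord (inord (t %/ 2 ^ k).-1 : 'I_T.+1); lia.
Qed.

(** An update touches one block for each level, repetition and scale; the factor 2 accounts for the
    old and the new update. *)
Lemma approx_sensitivity w t u u' :
  (\sum_N cnorm (approx_inc w t u N - approx_inc w t u' N)%R <=
   2 * (lg.+1 * (10 * rp) * lg.+1))%N.
Proof.
have one u0 : (\sum_N cnorm (approx_inc w t u0 N) <= lg.+1 * (10 * rp) *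
  lg.+1)%N.
  have -> : (lg.+1 * (10 * rp) * lg.+1)%N =
      (\sum_(a : ('I_lg.+1 * 'I_(10 * rp) * 'I_lg.+1)%type) 1)%N.
    by rewrite sum1_card !card_prod !card_ord.
  have -> : (\sum_N cnorm (approx_inc w t u0 N) =
      \sum_(a : ('I_lg.+1 * 'I_(10 * rp) * 'I_lg.+1)%type) \sum_(b : 'I_T.+1)
        cnorm (approx_inc w t u0 (a, b)))%N.
    by rewrite pair_bigA; apply: eq_bigr => -[a b] _.
  apply: leq_sum => a _.
  apply: (@sum_cnorm_single _ _ (fun b : 'I_T.+1 => (t %/ 2 ^ a.2)%N == b)
      (fun b => approx_inc w t u0 (a, b))).
  - by move=> b b' /eqP tb /eqP tb'; apply: val_inj; rewrite /= -tb -tb'.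
  - by move=> b /negbTE E; rewrite ffunE /= E.
  - move=> b; rewrite ffunE; case: ifP => // _.
    rewrite cnorm_intr_le1 // abszM.
    have := abs_coef (level a.1.1) (w.2 a.1.2) (hash enc w.1 u0.1).
    have := sign_abs u0.2; rewrite /=; nia.
rewrite [leqRHS]mul2n -addnn; apply: leq_trans (leq_add (one u) (one u')).
by rewrite -big_split; apply: leq_sum => N _; exact: cnormB.
Qed.

Definition counter (v : seed) (X : stream n T) (t : nat) (i : nat) (z : rep) :
  int :=
  \sum_g coef (level i) z g * hfreq (hash enc v) X t g.

Lemma abs_counter v X t i z : (`|counter v X t i z| <= T)%N.
Proof.
rewrite /counter -sum_hfreq; apply: abs_prefix_sum => g; exact: abs_coef.
Qed.

Lemma approx_zCDP (eps rho : R) : 0 <= eps ->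
  eps * (2 * (lg.+1 * (10 * rp) * lg.+1))%:R <= rho ->
  zCDP T rho (approx_mechanism eps).
Proof.
move=> eps0 er; apply: (mechanism_zCDP _ _ approx_causal eps0 er).
exact: approx_sensitivity.
Qed.

Hypothesis T_lt : (T < 2 ^ lg.+1)%N.

(** By [dyadic_prefix], every update before [t] is counted in exactly one of the blocks summed, and
    no other update is. *)
Lemma prefix_sketch w (X : stream n T) t i r : (t <= T)%N ->
  prefix_sum t (sketch_of approx_inc w X) i r =
  (counter w.1 X t i (w.2 r))%:~R.
Proof.
move=> tT; rewrite /prefix_sum /counter -sum_hfreq rmorph_sum /=.
pose F (j : 'I_T) : 'I_m.+2 :=
  (coef (level i) (w.2 r) (hash enc w.1 (tnth X j).1) * ssval (tnth X j).2)%:~R.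
transitivity (\sum_(j < T) F j *+ (j < t)%N).
  transitivity (\sum_(j < T) \sum_(k < lg.+1 | odd (t %/ 2 ^ k))
      F j *+ ((j %/ 2 ^ k)%N == (t %/ 2 ^ k).-1)).
    rewrite exchange_big /=; apply: eq_bigr => k _.
    rewrite /sketch_of sum_ffunE; apply: eq_bigr => j _; rewrite ffunE /=.
    rewrite inordK; last by have := leq_div t (2 ^ k); lia.
    by case: (_ == _).
  apply: eq_bigr => j _; rewrite sumrMnr; congr (_ *+ _).
  by apply: dyadic_prefix; apply: leq_ltn_trans T_lt.
by rewrite [RHS]big_mkcond; apply: eq_bigr => j _; case: (j < t)%N.
Qed.

Lemma prefix_sumD t y y' i r :
  prefix_sum t (y + y') i r = prefix_sum t y i r + prefix_sum t y' i r.
Proof. by rewrite /prefix_sum -big_split; apply: eq_bigr => k _;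
  rewrite ffunE. Qed.

Lemma prefix_noise t (y : sketch) i r : (forall N, cnorm (y N) <= k0)%N ->
  (cnorm (prefix_sum t y i r) <= tau)%N.
Proof.
move=> yk; apply: (leq_trans (cnorm_sum _ _ _)).
apply: (@leq_trans (\sum_(k < lg.+1) k0)%N).
  by rewrite big_mkcond; apply: leq_sum => k _; case: ifP.
by rewrite sum_nat_const card_ord.
Qed.

(** The gap between [2 * tau] and 0 lets the threshold [tau] absorb noise up to [tau] on either
    side. Supports of intermediate size are left unconstrained. *)
Definition calibrated_at (X : stream n T) (v : seed) (tab : table)
    (t : 'I_T) (i : 'I_lg.+1) : bool :=
  ((K * 2 ^ i <= #|support (hash enc v) X t.+1|)%N ==>
    (rp <= #|[set r | (2 * tau < `|counter v X t.+1 i (tab r)|)%N]%SET|)%N) &&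
  ((100 * #|support (hash enc v) X t.+1| <= 2 ^ i)%N ==>
    (#|[set r | counter v X t.+1 i (tab r) != 0]%SET| < rp)%N).

Definition calibrated X v tab : bool :=
  [forall t, forall i, calibrated_at X v tab t i].

Lemma cnorm_counter v X t i z : cnorm ((counter v X t i z)%:~R : 'I_m.+2) =
  `|counter v X t i z|%N.
Proof. by rewrite cnorm_intr //; have := abs_counter v X t i z; lia. Qed.

(** An active level has [2 ^ i < 100 * D], and every level with [K * 2 ^ i <= D] is active. The
    largest such level is within a factor [2 * K] of [D]. *)
Lemma approx_answer w (X : stream n T) (y : sketch) (t : 'I_T) :
  separated enc X w.1 -> calibrated X w.1 w.2 ->
  (forall N, cnorm (y N) <= k0)%N ->
  let e := (\max_(i | approx_dec w t.+1 (y + sketch_of approx_inc w X)%R i) 2 ^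
    i)%N in
  ((distinct X t <= 2 * K * e.+1) /\ (e <= 100 * distinct X t))%N.
Proof.
move=> sep cal yk /=; rewrite -(separatedP t sep).
set D := #|support _ _ _|; set f := approx_dec _ _ _;
  set e := (\max_(i | _) _)%N.
have calP i : calibrated_at X w.1 w.2 t i.
  by have /forallP/(_ t)/forallP/(_ i) := cal.
have detect i r : prefix_sum t.+1 (y + sketch_of approx_inc w X) i r =
    prefix_sum t.+1 y i r + (counter w.1 X t.+1 i (w.2 r))%:~R.
  by rewrite prefix_sumD prefix_sketch.
have active (i : 'I_lg.+1) : (K * 2 ^ i <= D)%N -> f i.
  move=> KD; have /andP[/implyP/(_ KD) hit _] := calP i.
  rewrite ffunE (leq_trans hit) // subset_leq_card //.
  apply/fintype.subsetP => r; rewrite !inE detect -(cnorm_counter w.1 X t.+1)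
    => big.
  have := prefix_noise t.+1 i r yk.
  have := cnormB (prefix_sum t.+1 y i r + (counter w.1 X t.+1 i (w.2 r))%:~R)
    (prefix_sum t.+1 y i r).
  rewrite addrC addKr; lia.
have passive (i : 'I_lg.+1) : f i -> (2 ^ i < 100 * D)%N.
  rewrite ltnNge ffunE => fi; apply/negP => Di.
  have /andP[_ /implyP/(_ Di)] := calP i; apply/negP; rewrite -leqNgt.
  rewrite (leq_trans fi) // subset_leq_card //.
  apply/fintype.subsetP => r; rewrite !inE detect; apply: contraTneq => ->.
  by rewrite addr0 -leqNgt prefix_noise.
split; last by apply/bigmax_leqP => i /passive /ltnW.
have DT : (D < 2 ^ lg.+1)%N by apply: leq_ltn_trans T_lt; exact: card_support.
(* If the least such [j] is 0, then [D < K] and possibly no level is active; the successor in [e.+1]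
   covers this case. *)
have exj : exists j, (D < K * 2 ^ j)%N.
  by exists lg.+1; apply: (leq_trans DT); rewrite leq_pmull // /K; lia.
case: (ex_minnP exj) => [[|j]] Dj minj; first by move: Dj; rewrite expn0; nia.
have Kj : (K * 2 ^ j <= D)%N.
  by rewrite leqNgt; apply/negP => /minj; rewrite ltnn.
have jlg : (j < lg.+1)%N.
  rewrite -(@ltn_exp2l 2) //; apply: leq_ltn_trans DT; apply: leq_trans Kj.
  by rewrite leq_pmull // /K; lia.
have ej : (2 ^ j <= e)%N.
  exact: (@leq_bigmax_cond _ f (fun i : 'I_lg.+1 => 2 ^ i)%N (Ordinal jlg)
    (active (Ordinal jlg) Kj)).
move: Dj; rewrite expnS; nia.
Qed.

(** A missed level has more than [9 * rp] misses, each of probability at most 5/6, and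
    [(11/6)^10 / 2^9 <= 6/7]. A false alarm has at least [rp] nonzero counters, each of probability
    at most 1/100, and [(101/100)^10 / 2 <= 6/7]. *)
Lemma count_not_calibrated_at X v t i :
  #|[set tab : table | ~~ calibrated_at X v tab t i]%SET|%:R <=
  2 * (6 / 7) ^+ rp * #|{: table}|%:R :> R.
Proof.
set D := #|support (hash enc v) X t.+1|.
pose miss : {set rep} := [set z | (`|counter v X t.+1 i z| <= 2 * tau)%N]%SET.
pose nz : {set rep} := [set z | counter v X t.+1 i z != 0]%SET.
pose B1 := [set tab : table | (K * 2 ^ i <= D) && (9 * rp <= #|[set r | tab r
  \in miss]|)]%SET%N.
pose B2 := [set tab : table | (100 * D <= 2 ^ i) && (1 * rp <= #|[set r | tab r
  \in nz]|)]%SET%N.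
have sub : [set tab | ~~ calibrated_at X v tab t i]%SET \subset B1 :|: B2.
  apply/fintype.subsetP => tab; rewrite !inE negb_and !negb_imply -!ltnNge.
  case/orP => /andP[-> few] /=; apply/orP; [left|right]; last first.
    rewrite mul1n; rewrite ltnS in few; apply: (leq_trans few).
    by apply/eq_leq/eq_card => r; rewrite !inE.
  have := cardsC [set r | tab r \in miss]%SET; rewrite card_ord.
  have : (#|~: [set r | tab r \in miss]%SET| < rp)%N.
    by apply: leq_ltn_trans few; apply/eq_leq/eq_card => r;
      rewrite !inE -ltnNge.
  by move: #|~: _| #|finset _| => a b /ltnW ar abr; rewrite -(leq_add2r a) abr;
    lia.
have tail1 : #|B1|%:R <= (6 / 7) ^+ rp * #|{: table}|%:R :> R.
  have [KD|KD] := boolP (K * 2 ^ i <= D)%N; last first.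
    rewrite /B1 (negbTE KD) (_ : [set tab | _]%SET = finset.set0) ?cards0.
      by rewrite mulr_ge0 ?exprn_ge0 ?ler0n //; lra.
    by apply/setP => tab; rewrite !inE.
  have := @count_missed_detection R G _ (level i) (2 ^ i) _ (card_level i)
    (hfreq (hash enc v) X t.+1) tau.
  rewrite expn_gt0 => /(_ isT KD) hmiss.
  rewrite /B1 KD /=.
  apply: (@repetition_tail R _ (mem miss) rp 9 (11 / 6)) => //.
    have : (6 * #|miss|)%:R <= (5 * #|{: rep}|)%:R :> R by rewrite ler_nat.
    rewrite !natrM; lra.
  lra.
have tail2 : #|B2|%:R <= (6 / 7) ^+ rp * #|{: table}|%:R :> R.
  have [KD|KD] := boolP (100 * D <= 2 ^ i)%N; last first.
    rewrite /B2 (negbTE KD) (_ : [set tab | _]%SET = finset.set0) ?cards0.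
      by rewrite mulr_ge0 ?exprn_ge0 ?ler0n //; lra.
    by apply/setP => tab; rewrite !inE.
  have := @count_false_detection G _ (level i) (2 ^ i) _ (card_level i)
    (hfreq (hash enc v) X t.+1).
  rewrite expn_gt0 => /(_ isT KD) hnz.
  rewrite /B2 KD /=.
  apply: (@repetition_tail R _ (mem nz) rp 1 (101 / 100)) => //.
    have : (100 * #|nz|)%:R <= #|{: rep}|%:R :> R by rewrite ler_nat.
    rewrite !natrM; lra.
  lra.
apply: (@le_trans _ _ (#|B1| + #|B2|)%:R).
  by rewrite ler_nat (leq_trans (subset_leq_card sub)) // leq_card_setU.
rewrite natrD; lra.
Qed.

Lemma count_not_calibrated X v :
  #|[set tab : table | ~~ calibrated X v tab]%SET|%:R <=
  (T * lg.+1)%:R * (2 * (6 / 7) ^+ rp) * #|{: table}|%:R :> R.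
Proof.
apply: (@le_trans _ _ (\sum_(p : 'I_T * 'I_lg.+1)
    #|[set tab : table | ~~ calibrated_at X v tab p.1 p.2]%SET|%:R)).
  rewrite -natr_sum ler_nat.
  apply: (@leq_trans (\sum_(tab : table) \sum_(p : 'I_T * 'I_lg.+1)
      ~~ calibrated_at X v tab p.1 p.2)%N).
    rewrite -sum1dep_card big_mkcond; apply: leq_sum => tab _; case: ifP => //.
    rewrite negb_forall => /existsP[t]; rewrite negb_forall => /existsP[i bad].
    by rewrite (bigD1 (t, i)) //= bad.
  rewrite exchange_big; apply: leq_sum => p _.
  rewrite -sum1dep_card [leqRHS]big_mkcond; apply: leq_sum => tab _.
  by case: (calibrated_at _ _ _ _ _).
apply: (le_trans (ler_sum _ (fun p _ => count_not_calibrated_at X v p.1 p.2))).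
by rewrite sumr_const card_prod !card_ord -[leRHS]mulrA [leRHS]mulr_natl.
Qed.

Hypothesis enc_inj : injective enc.

Lemma approx_solves (eps g1 g2 g3 gamma : R) : 0 <= eps ->
  (T ^ 2)%:R <= g1 * gm.+2%:R ->
  (T * lg.+1)%:R * (2 * (6 / 7) ^+ rp) <= g3 ->
  (lg.+1 * (10 * rp) * lg.+1 * T.+1 * m.+2)%:R * expR (- (eps * k0.+1%:R)) <=
    g2 ->
  g1 + g3 + g2 <= gamma ->
  solves_distinct T (approx_mechanism eps) ((2 * K)%:R * 100) 1 gamma.
Proof.
(* The additive error 1 is the successor in [D <= 2 * K * e.+1], divided by [2 * K]. *)
move=> eps0 hg1 hg3 hg2 g123; exists (2 * K)%:R, 100, 1, 0.
split; first by split => //; [rewrite ler1n /K; lia|rewrite ler1n].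
split; first by rewrite addr0.
move=> X; apply: (@le_trans _ _ (1 - ((g1 + g3) + g2))).
  by rewrite lerD2l lerN2.
pose A (w : seed * table) := separated enc X w.1 && calibrated X w.1 w.2.
apply: (mechanism_success _ _ approx_causal (A := A) (k := k0)) => //.
- move=> w y /andP[sep cal] yk; apply/forallP => t; rewrite tnth_mktuple /=.
  have [lo hi] := approx_answer t sep cal yk.
  rewrite /approx_est addr0 -natrM ler_nat hi andbT.
  rewrite lerBlDr ler_pdivrMr; last by rewrite ltr0n /K; lia.
  by rewrite natr1 -natrM ler_nat mulnC.
- rewrite card_prod natrM mulrDl.
  pose B1 := finset.setX [set v : seed | ~~ separated enc X v]%SET [set:
    table]%SET.
  pose B2 := [set w : seed * table | ~~ calibrated X w.1 w.2]%SET.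
  have sub : (#|[pred w | ~~ A w]| <= #|B1| + #|B2|)%N.
    apply: leq_trans (leq_card_setU B1 B2).1; apply: subset_leq_card.
    by apply/fintype.subsetP => w; rewrite !inE negb_and andbT.
  apply: (@le_trans _ _ (#|B1| + #|B2|)%:R); first by rewrite ler_nat.
  rewrite natrD lerD //.
    rewrite cardsX cardsT natrM mulrA ler_wpM2r ?ler0n //.
    exact: count_not_separated.
  have -> : #|B2|%:R = \sum_(v : seed)
      #|[set tab : table | ~~ calibrated X v tab]%SET|%:R :> R.
    rewrite -natr_sum; congr (_%:R).
    rewrite -sum1_card (eq_bigl (fun w : seed * table => ~~ calibrated X w.1
      w.2)).
      rewrite -(pair_big_dep xpredT (fun v tab => ~~ calibrated X v tab) (fun _
        _ => 1%N)) /=.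
      by apply: eq_bigr => v _; rewrite sum1dep_card.
    by move=> w; rewrite inE.
  apply: (le_trans (ler_sum _ (fun v _ => count_not_calibrated X v))).
  rewrite sumr_const -[leLHS]mulr_natl [leRHS]mulrCA ler_wpM2l ?ler0n //.
  by rewrite ler_wpM2r ?ler0n.
- by rewrite -natrM !card_prod !card_ord.
Qed.

Lemma card_approx_memory (eps : R) :
  #|memory (approx_mechanism eps)| =
  (gm.+2 ^ L * ((2 ^ lg) ^ gm.+2 * 2 ^ gm.+2) ^ (10 * rp) * T.+1 *
   m.+2 ^ (lg.+1 * (10 * rp) * lg.+1 * T.+1))%N.
Proof.
by rewrite card_mechanism_memory !card_prod !card_ffun !card_prod !card_ffun
  card_bool !card_ord.
Qed.

End Approximate.

(** * Choice of the parameters *)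

Lemma ln2_ge (R : realType) : 2^-1 <= ln 2 :> R.
Proof.
have := expR_ge1Dx (- ln 2 : R); rewrite expRN lnK ?posrE //; lra.
Qed.

Lemma natr_ln_ge (R : realType) (T : nat) : (2 <= T)%N -> 2^-1 <= ln T%:R :> R.
Proof.
move=> T2; apply: (le_trans (ln2_ge R)).
by rewrite ler_ln ?posrE ?ltr0n ?ler_nat //; lia.
Qed.

Lemma exponent_le_ln (R : realType) (T lg : nat) : (2 ^ lg <= T)%N ->
  lg%:R <= 2 * ln T%:R :> R.
Proof.
move=> lgT.
have : ln (2 ^+ lg) <= ln T%:R :> R.
  rewrite ler_ln ?posrE ?exprn_gt0 //; first by rewrite -natrX ler_nat.
  by rewrite ltr0n; apply: leq_trans lgT; rewrite expn_gt0.
rewrite lnXn // -[_ *+ lg]mulr_natl => h.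
have lg0 : 0 <= lg%:R :> R by rewrite ler0n.
have := ln2_ge R; nra.
Qed.

Lemma expR_mul_ln (R : realType) (T e : nat) : (0 < T)%N ->
  expR (- (e%:R * ln T%:R)) = T%:R ^- e :> R.
Proof. by move=> T0; rewrite expRN expRM_natl lnK // posrE ltr0n. Qed.

Lemma space_le (R : realType) (n T E : nat) (A : algorithm R n) :
  (0 < T)%N -> (#|memory A| <= 2 ^ (word_size n T * E))%N -> (space T A <= E)%N.
Proof.
move=> T0 memA; apply: up_log_min; last by rewrite -expnM.
have : (0 < word_size n T)%N by rewrite up_log_gt0; lia.
by move=> w0; rewrite -{1}(expn0 2) ltn_exp2l.
Qed.

(** Codes of one word keep the seed small: one group element per bit of a word, that is, as many
    words as a group element has bits. *)
Lemma code_for_universe (n T : nat) :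
  exists enc : 'I_n -> {set 'I_(word_size n T)}, injective enc.
Proof.
apply: code_exists; apply: (@leq_trans (n + T).+1); first lia.
exact: up_logP.
Qed.

Lemma le_pow2X (a x k : nat) : (a <= 2 ^ x -> a ^ k <= 2 ^ (x * k))%N.
Proof. by case: k => [|k] ax; rewrite ?muln0 // expnM leq_exp2r. Qed.

Lemma le_pow2M (a b x y : nat) :
  (a <= 2 ^ x -> b <= 2 ^ y -> a * b <= 2 ^ (x + y))%N.
Proof. by move=> ax byy; rewrite expnD leq_mul. Qed.

Section Tuning.
Variables (R : realType) (c n T : nat).
Hypothesis T2 : (2 <= T)%N.
Local Notation l := (ln T%:R : R).
Local Notation gm := (T ^ c.+4).-2.

Let T0 : 0 < T%:R :> R.
Proof. by rewrite ltr0n; lia. Qed.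

Lemma gmE : gm.+2 = (T ^ c.+4)%N.
Proof.
have : (2 ^ 1 <= T ^ c.+4)%N.
  by apply: (@leq_trans (T ^ 1)%N); [rewrite !expn1|rewrite leq_exp2l].
lia.
Qed.

Lemma counter_range_le : ((2 * T).+2 <= 2 ^ (2 * T))%N.
Proof.
have T1 : (T < 2 ^ T)%N by exact: ltn_expl.
by rewrite mul2n -addnn expnD; nia.
Qed.

Lemma seed_space (L : nat) : ((T ^ c.+4) ^ L <= 2 ^ (T * c.+4 * L))%N.
Proof. by do 2 apply: le_pow2X; apply/ltnW/ltn_expl. Qed.

Lemma pow_ge (e : nat) : (e <= c + 6 -> T ^ e <= T ^ (c + 6))%N.
Proof. by move=> ec; rewrite leq_exp2l. Qed.

Lemma separation_rate : (T ^ 2)%:R <= T%:R ^- c.+2 * gm.+2%:R :> R.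
Proof.
rewrite gmE natrX natrX mulrC -exprB ?unitfE ?gt_eqF //; last lia.
by rewrite (_ : c.+4 - c.+2 = 2)%N //; lia.
Qed.

(** Each failure event is given probability [T ^- c.+2]; as [T ^ 2 >= 4], three of them fit into
    [T ^- c]. *)
Lemma three_rates : 3 * T%:R ^- c.+2 <= T%:R ^- c :> R.
Proof.
have Tc : 0 < T%:R ^- c :> R by rewrite invr_gt0 exprn_gt0.
have -> : T%:R ^- c.+2 = T%:R ^- c * T%:R ^- 2 :> R by rewrite -invfM -exprD
  addn2.
have T4 : (4 : R) <= T%:R ^+ 2 by rewrite -natrX ler_nat; nia.
have : T%:R ^- 2 <= 4^-1 :> R by rewrite lef_pV2 ?posrE ?exprn_gt0.
nra.
Qed.

Lemma exact_regime (rho : R) : 64 * c.+4.+1%:R * l ^+ 5 <= rho -> 0 < rho ->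
  exists A : algorithm R n,
    [/\ zCDP T rho A, (space T A <= 600 * c.+4.+1 * T ^ (c + 6))%N &
        solves_distinct T A 1 0 (T%:R ^- c)].
Proof.
move=> rho_ge rho0; have [enc enc_inj] := code_for_universe n T.
have l2 := natr_ln_ge R T2.
exists (exact_mechanism T gm enc (rho / 2)); split.
- by apply: exact_zCDP; [rewrite divr_ge0 // ltW|rewrite divfK].
- apply: space_le; first lia.
  rewrite card_exact_memory gmE.
  apply: (leq_trans (le_pow2M (le_pow2M (seed_space _) (ltn_expl T (leqnn 2)))
    (le_pow2X _ counter_range_le))).
  have w0 : (0 < word_size n T)%N by rewrite up_log_gt0; lia.
  rewrite leq_exp2l //; move: (word_size n T) w0 => w w0.
  have T1 : (T <= T ^ (c + 6))%N by rewrite -{1}(expn1 T) pow_ge //; lia.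
  have e1 : (T * c.+4 * w <= w * (c.+4 * T ^ (c + 6)))%N by nia.
  have e2 : (T <= w * T ^ (c + 6))%N by nia.
  have e3 : (2 * T * (T * T ^ c.+4) <= w * (2 * T ^ (c + 6)))%N.
    by rewrite -expnS -mulnA -expnS (_ : c.+4.+2 = c + 6)%N //; nia.
  apply: (@leq_trans (w * (c.+4 * T ^ (c + 6)) + w * T ^ (c + 6) + w * (2 * T ^
    (c + 6)))%N).
    by rewrite !leq_add.
  rewrite -!mulnDr leq_mul2l; apply/orP; right; nia.
- apply: (@exact_solves _ _ _ _ _ _ enc_inj _ (T%:R ^- c.+2) (T%:R ^- c.+2)).
  + by rewrite divr_ge0 // ltW.
  + exact: separation_rate.
  + have rate : expR (- (rho / 2)) <= T%:R ^- (2 * c + 10) :> R.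
      rewrite -expR_mul_ln; last lia.
      rewrite ler_expR lerN2.
      have c5 : (2 * c + 10)%:R = 2 * c.+4.+1%:R :> R by rewrite -natrM;
        congr (_%:R); lia.
      (* From [ln T >= 1/2]. It turns the assumption on [l ^+ 5] into
         [rho / 2 >= (2 * c + 10) * l]. *)
      have l4 : 1 / 16 <= l ^+ 4.
        apply: (@le_trans _ _ (2^-1 ^+ 4)); first lra.
        by rewrite lerXn2r ?nnegrE //; lra.
      have cl : 0 <= c.+4.+1%:R * l by rewrite mulr_ge0 ?ler0n //; lra.
      move: rho_ge; rewrite exprS c5.
      move: cl l4; move: (l ^+ 4) => l4 cl l4_ge; nra.
    apply: (le_trans (ler_wpM2l _ rate)); first by rewrite ler0n.
    rewrite gmE ler_pdivrMr ?exprn_gt0 // mulrC -exprB ?unitfE ?gt_eqF //;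
      last lia.
    rewrite -natrX ler_nat (_ : 2 * c + 10 - c.+2 = c.+4 + 4)%N; last lia.
    have T4 : (2 * T + 2 <= T ^ 3)%N by rewrite !expnS expn0; nia.
    rewrite (leq_trans (leq_mul (leqnn _) (_ : _ <= T ^ 3)%N)) //; first lia.
    by rewrite -expnS -expnD leq_exp2l //; lia.
  + have := three_rates.
    have : 0 < T%:R ^- c.+2 :> R by rewrite invr_gt0 exprn_gt0.
    lra.
Qed.

Lemma repetitions_le lg : (lg.+1 <= T ->
  10 * (10 * c.+4.+1 * lg) <= 100 * c.+4.+1 * T)%N.
Proof. by move=> lgT; nia. Qed.

(** The exponent [c + 6] comes from the sampling tables: [T ^ c.+4] keys, at most [T] bits per key,
    and [O(T)] repetitions. *)
Lemma approx_space (lg k0 : nat) (enc : 'I_n -> {set 'I_(word_size n T)})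
    (eps : R) : (lg.+1 <= T)%N ->
  (space T (approx_mechanism T gm lg (10 * c.+4.+1 * lg) k0 enc eps) <=
   600 * c.+4.+1 * T ^ (c + 6))%N.
Proof.
move=> lgT1; have rp_le := repetitions_le lgT1.
move: rp_le; set rp := (10 * c.+4.+1 * lg)%N => rp_le.
apply: space_le; first lia.
rewrite card_approx_memory gmE.
have rep_space : ((2 ^ lg) ^ (T ^ c.+4) * 2 ^ (T ^ c.+4) <= 2 ^ (lg.+1 * T ^
  c.+4))%N.
  by rewrite -expnM -expnD mulSn addnC.
apply: (leq_trans (le_pow2M (le_pow2M (le_pow2M (seed_space _) (le_pow2X _
  rep_space))
  (ltn_expl T (leqnn 2))) (le_pow2X _ counter_range_le))).
have w0 : (0 < word_size n T)%N by rewrite up_log_gt0; lia.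
rewrite leq_exp2l //; move: (word_size n T) w0 => w w0.
clearbody rp.
have T1 : (T <= T ^ (c + 6))%N by rewrite -{1}(expn1 T) pow_ge //; lia.
have T5 : (T ^ 5 <= T ^ (c + 6))%N by rewrite pow_ge //; lia.
have e1 : (T * c.+4 * w <= w * (c.+4 * T ^ (c + 6)))%N by nia.
have e2 : (T <= w * T ^ (c + 6))%N by nia.
have e3 : (lg.+1 * T ^ c.+4 * (10 * rp) <= w * (100 * c.+4.+1 * T ^ (c + 6)))%N.
  apply: (@leq_trans (T * T ^ c.+4 * (100 * c.+4.+1 * T)))%N.
    by apply: leq_mul rp_le; rewrite leq_mul2r lgT1 orbT.
  rewrite -expnS mulnCA -expnSr (_ : c.+4.+2 = c + 6)%N //; last lia.
  by rewrite leq_pmull.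
have e4 : (2 * T * (lg.+1 * (10 * rp) * lg.+1 * T.+1) <= w * (400 * c.+4.+1 * T
  ^ (c + 6)))%N.
  apply: (@leq_trans (2 * T * (T * (100 * c.+4.+1 * T) * T * (2 * T))))%N.
    by do !apply: leq_mul => //; lia.
  apply: (@leq_trans (400 * c.+4.+1 * T ^ 5))%N; first by rewrite !expnS expn0;
    lia.
  by apply: leq_trans (leq_pmull _ w0); rewrite leq_mul2l T5 orbT.
apply: (@leq_trans (w * (c.+4 * T ^ (c + 6)) + w * (100 * c.+4.+1 * T ^ (c +
  6)) +
    w * T ^ (c + 6) + w * (400 * c.+4.+1 * T ^ (c + 6)))%N).
  by rewrite !leq_add.
rewrite -!mulnDr leq_mul2l; apply/orP; right; nia.
Qed.

(** Since [(6/7)^10 <= 1/4] and [T < 2 ^ lg.+1 <= 4 ^ lg], every [10 * lg] repetitions in [rp] gain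
    a factor [1 / T]. Of the [c + 5] factors, three pay for the union bound over times and
    levels. *)
Lemma repetition_rate lg : (T < 2 ^ lg.+1)%N -> (1 <= lg)%N -> (lg.+1 <= T)%N ->
  (T * lg.+1)%:R * (2 * (6 / 7) ^+ (10 * c.+4.+1 * lg)) <= T%:R ^- c.+2 :> R.
Proof.
move=> Tlg lg1 lgT1.
have rate : (6 / 7) ^+ (10 * c.+4.+1 * lg) <= T%:R ^- c.+4.+1 :> R.
  have q10 : (6 / 7) ^+ 10 <= 4^-1 :> R by lra.
  rewrite -mulnA exprM; apply: (@le_trans _ _ (4^-1 ^+ (c.+4.+1 * lg))).
    by rewrite lerXn2r ?nnegrE //; lra.
  rewrite mulnC exprM -[leRHS]exprVn.
  rewrite lerXn2r ?nnegrE ?exprn_ge0 ?invr_ge0 ?(ltW T0) // exprVn.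
  rewrite -natrX lef_pV2 ?posrE // ?ltr0n ?expn_gt0 // ler_nat.
  by rewrite (leq_trans (ltnW Tlg)) // -[4%N]/(2 ^ 2)%N -expnM leq_exp2l //;
    lia.
apply: (@le_trans _ _ ((T ^ 3)%:R * T%:R ^- c.+4.+1)).
  rewrite mulrA ler_pM ?mulr_ge0 ?ler0n ?exprn_ge0 //.
  rewrite -natrM ler_nat !expnS expn0 muln1 mulnA leq_mul //.
  by rewrite leq_mul.
rewrite natrX ler_pdivrMr ?exprn_gt0 // mulrC -exprB ?unitfE ?gt_eqF //;
  last lia.
by rewrite (_ : c.+4.+1 - c.+2 = 3)%N //; lia.
Qed.

(** There are at most [800 * c.+4.+1 * T ^ 5] pairs of a node and a group element, and
    [800 * c.+4.+1 <= T ^ (c + 15)]; this gives [2 * c + 22 = (c + 2) + (c + 15) + 5]. *)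
Lemma noise_rate lg (x : R) : (lg.+1 <= T)%N -> (2 * c + 22)%:R * l <= x ->
  (lg.+1 * (10 * (10 * c.+4.+1 * lg)) * lg.+1 * T.+1 * (2 * T).+2)%:R *
    expR (- x) <= T%:R ^- c.+2.
Proof.
move=> lgT1 x_ge; have rp_le := repetitions_le lgT1.
have rate : expR (- x) <= T%:R ^- (2 * c + 22) :> R.
  rewrite -expR_mul_ln; last lia.
  by rewrite ler_expR lerN2.
apply: (le_trans (ler_wpM2l _ rate)); first by rewrite ler0n.
rewrite ler_pdivrMr ?exprn_gt0 // mulrC -exprB ?unitfE ?gt_eqF //; last lia.
rewrite -natrX ler_nat (_ : 2 * c + 22 - c.+2 = c.+4.+1 + 10 + 5)%N; last lia.
have c_le : (800 * c.+4.+1 <= T ^ (c.+4.+1 + 10))%N.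
  apply: (@leq_trans (2 ^ (c.+4.+1 + 10)))%N;
    last by rewrite leq_exp2r // addn10.
  by rewrite expnD mulnC leq_mul //; apply/ltnW/ltn_expl.
rewrite expnD; apply: (@leq_trans (800 * c.+4.+1 * T ^ 5))%N;
  last by rewrite leq_mul2r c_le orbT.
apply: (@leq_trans (T * (100 * c.+4.+1 * T) * T * (2 * T) * (4 * T)))%N.
  by do !apply: leq_mul => //; lia.
by rewrite !expnS expn0; lia.
Qed.

Lemma approx_regime (rho : R) : 0 < rho ->
  exists (tau : nat) (A : algorithm R n),
    [/\ tau%:R <= 32 * 800 * (2 * c + 22)%:R * c.+4.+1%:R * (l ^+ 5 / rho),
        zCDP T rho A,
        (space T A <= 600 * c.+4.+1 * T ^ (c + 6))%N &
        solves_distinct T A ((2 * (64 * tau ^ 2 + 16))%:R * 100) 1 (T%:R ^- c)].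
Proof.
move=> rho0; have [enc enc_inj] := code_for_universe n T.
have l2 := natr_ln_ge R T2.
have l0 : 0 < l by lra.
pose lg := trunc_log 2 T.
have /andP[lgT Tlg] : (2 ^ lg <= T < 2 ^ lg.+1)%N by apply: trunc_log_bounds =>
  //; lia.
have lg1 : (1 <= lg)%N.
  by rewrite -(@leq_exp2l 2) // -ltnS; move: Tlg; rewrite expnS; lia.
have lgl : lg%:R <= 2 * l by exact: exponent_le_ln.
have lgT1 : (lg.+1 <= T)%N by apply: leq_trans lgT; exact: ltn_expl.
have lg1R : lg.+1%:R <= 4 * l.
  by have : 1 <= lg%:R :> R; [rewrite ler1n|rewrite -natr1; lra].
pose rp := (10 * c.+4.+1 * lg)%N.
pose Delta := (2 * (lg.+1 * (10 * rp) * lg.+1))%N.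
have Delta0 : 0 < Delta%:R :> R by rewrite ltr0n /Delta /rp; nia.
have Delta_le : Delta%:R <= 8 * 800 * c.+4.+1%:R * l ^+ 3.
  apply: (@le_trans _ _ (800 * c.+4.+1%:R * lg%:R ^+ 3)).
    rewrite -natrX -!natrM ler_nat /Delta /rp !expnS expn0; nia.
  have : c.+4.+1%:R * lg%:R ^+ 3 <= c.+4.+1%:R * (2 * l) ^+ 3 :> R.
    by rewrite ler_wpM2l ?ler0n // lerXn2r ?nnegrE ?ler0n //; lra.
  lra.
pose eps := rho / Delta%:R.
have eps0 : 0 < eps by rewrite divr_gt0.
pose E := (2 * c + 22)%N.
(* Truncation gives both bounds: [k0] enters [tau] from above, and [k0.+1] enters the noise tail
   from below. With [Delta = O(l ^+ 3)], [tau] is [O(l * l * l ^+ 3 / rho)]. *)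
pose k0 := Num.truncn (E%:R * l / eps).
have El0 : 0 <= E%:R * l / eps by rewrite !mulr_ge0 ?ler0n ?invr_ge0 ?(ltW
  eps0) ?(ltW l0).
have k0_le : k0%:R <= E%:R * l / eps by rewrite truncn_le.
have k0_gt : E%:R * l < eps * k0.+1%:R.
  by rewrite [ltRHS]mulrC -ltr_pdivrMr // /k0 truncnS_gt.
exists (lg.+1 * k0)%N, (approx_mechanism T gm lg rp k0 enc eps); split.
- rewrite natrM.
  apply: (@le_trans _ _ (4 * l * (E%:R * l / eps))).
    by rewrite ler_pM ?ler0n.
  rewrite /eps invfM invrK.
  apply: (@le_trans _ _ (4 * l * (E%:R * l * (rho^-1 * (8 * 800 * c.+4.+1%:R *
    l ^+ 3))))).
    rewrite !ler_wpM2l // ?invr_ge0 ?mulr_ge0 ?ler0n ?(ltW l0) ?(ltW rho0) //.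
  rewrite -/E; move: (E%:R : R) (c.+4.+1%:R : R) => e c5.
  by rewrite le_eqVlt; apply/orP; left; apply/eqP; field; rewrite gt_eqF.
- by apply: approx_zCDP; [exact: ltW|rewrite divfK // gt_eqF].
- exact: approx_space.
- apply: (@approx_solves _ _ _ _ _ _ _ _ _ Tlg enc_inj _ (T%:R ^- c.+2)
    (T%:R ^- c.+2) (T%:R ^- c.+2)).
  + exact: ltW.
  + exact: separation_rate.
  + exact: repetition_rate.
  + by apply: noise_rate => //; rewrite ltW.
  + have := three_rates; lra.
Qed.

End Tuning.

Theorem theorem4p1 (R : realType) :
  forall c : nat,
  exists (C : R) (B d : nat), 0 < C /\
  forall (n T : nat) (rho : R), (2 <= T)%N -> 0 < rho ->
  exists A : algorithm R n,
    [/\ zCDP T rho A,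
        (space T A <= B * T ^ d)%N &
        exists alpha beta : R,
          [/\ alpha <= Num.max 1 (C * (ln T%:R ^+ 10 / rho ^+ 2)),
              beta <= C * (ln T%:R ^+ 10 / rho ^+ 2) &
              solves_distinct T A alpha beta (T%:R ^- c)]].
Proof.
move=> c.
have [a aE] : exists a : R, a = 32 * 800 * (2 * c + 22)%:R * c.+4.+1%:R by
  eexists.
have [b bE] : exists b : R, b = 64 * c.+4.+1%:R by eexists.
have a0 : 0 <= a by rewrite aE !mulr_ge0 ?ler0n.
have b0 : 0 < b by rewrite bE mulr_gt0 ?ltr0n.
(* The factor [100 * (128 * tau ^ 2 + 32)] of the approximate mechanism, with [tau <= a * s] and
   [1 <= b * s] for [s = l ^+ 5 / rho]. *)
pose C : R := 100 * (128 * a ^+ 2 + 32 * b ^+ 2).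
have C0 : 0 < C.
  have := sqr_ge0 a; have : 0 < b ^+ 2 by rewrite exprn_gt0.
  rewrite /C; lra.
exists C, (600 * c.+4.+1)%N, (c + 6)%N; split => // n T rho T2 rho0.
have l2 := natr_ln_ge R T2.
set l := ln T%:R in l2 *.
have l0 : 0 < l by lra.
pose s := l ^+ 5 / rho.
have s0 : 0 < s by rewrite divr_gt0 ?exprn_gt0.
have sE : l ^+ 10 / rho ^+ 2 = s ^+ 2.
  by rewrite /s expr_div_n -exprM.
rewrite sE.
(* For large [rho] the quantity [C * s ^+ 2] may fall below 1, and the exact answers match the
   maximum with 1 in the bound on [alpha]. *)
have [large|small] := lerP (b * l ^+ 5) rho.
  rewrite bE in large.
  have [A [priv spaceA solA]] := exact_regime n T2 large rho0.
  exists A; split => //; exists 1, 0; split => //.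
    by rewrite le_max lexx.
  by rewrite mulr_ge0 ?exprn_ge0 ?ltW.
have [tau [A [tau_le priv spaceA solA]]] := approx_regime c n T2 rho0.
rewrite -aE -/l -/s in tau_le.
(* For small [rho] this absorbs the constant terms of [alpha] and the additive error 1. *)
have bs : 1 <= b * s.
  by rewrite /s mulrA ler_pdivlMr // mul1r ltW.
have bs2 : 1 <= b ^+ 2 * s ^+ 2 by rewrite -exprMn exprn_ege1.
exists A; split => //; exists ((2 * (64 * tau ^ 2 + 16))%:R * 100), 1;
  split => //.
  rewrite le_max; apply/orP; right.
  have tau2 : tau%:R ^+ 2 <= a ^+ 2 * s ^+ 2.
    by rewrite -exprMn lerXn2r ?nnegrE ?ler0n ?(mulr_ge0 a0 (ltW s0)).
  rewrite natrM natrD natrM natrX /C; lra.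
rewrite /C; have : 0 <= a ^+ 2 * s ^+ 2 by rewrite -exprMn sqr_ge0.
lra.
Qed.
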